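(* Let $n\ge1$ and suppose the scale factor $a$ satisfies Assumption $H_3$. If $$\inf_{\alpha\in\mathbb R^n}\det\Big(\frac{\partial v_0}{\partial\alpha}(\alpha)\Big)<0,$$ then, for all sufficiently small $\varepsilon>0$, the classical solution $v$ of the Cauchy problem $$\begin{cases}\dfrac{\partial v^i}{\partial t}+\displaystyle\sum_{j=1}^{n}\frac{v^j}{a(t)}\frac{\partial v^i}{\partial x^j}+\frac{\dot a(t)}{a(t)}v^i-\frac{\dot a(t)}{a(t)}\frac{|v|^2}{c^2}v^i=0,\quad i=1,\dots,n,\\ v(0,x)=\varepsilon v_0(x),\end{cases}$$ is such that $|\nabla v|$ tends to infinity in finite time.
   Context: $c>0$ is a constant. The unknown is $v=(v^1,\dots,v^n)$ with $|v|^2=\sum_i(v^i)^2$; $\nabla$ is the gradient in $x\in\mathbb R^n$. The datum $v_0\in C^2(\mathbb R^n;\mathbb R^n)$ has bounded $C^2$ norm, and $\frac{\partial v_0}{\partial\alpha}$ is its Jacobian matrix $(\partial v_0^i/\partial\alpha^j)$. A classical solution is a $C^1$ solution. ''$|\nabla v|$ tends to infinity in finite time'' means there is $T_*<\infty$ such that the classical solution exists on $[0,T_* )\times\mathbb R^n$ and $\sup_x|\nabla v(t,x)|\to\infty$ as $t\to T_*$. The scale factor $a:[0,\infty)\to(0,\infty)$ is twice differentiable with $a(0)=1$. Assumption $H_3$: $\dot a(t)>0$ and $\ddot a(t)<0$, and there is a constant $0<l\le\frac12$ with $a(t)\sim(1+t)^l$ (i.e. $C^{-1}(1+t)^l\le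 a(t)\le C(1+t)^l$ for some constant $C>0$). *)

(* Defs.v *)
From HB Require Import structures.
From mathcomp Require Import all_boot all_order all_algebra.
From mathcomp Require Import all_classical all_reals all_analysis.

Set Implicit Arguments.
Unset Strict Implicit.
Unset Printing Implicit Defensive.

Import Order.TTheory GRing.Theory Num.Theory.
Import numFieldNormedType.Exports.

Local Open Scope classical_set_scope.
Local Open Scope ring_scope.

(* Derivative of a function of time on the half-line [0, +oo[: increments h are
   restricted to 0 <= t + h, so that it is the right derivative at t = 0 and the
   usual derivative at t > 0, and values at negative times are irrelevant. *)
Definition diff_quot_time (R : realType) (f : R -> R) (t : R) : R -> R :=
  fun h => (f (t + h) - f t) / h.

Definition derivable_time (R : realType) (f : R -> R) (t : R) : Prop :=
  cvg (diff_quot_time f t h @[h --> within [set h | 0 <= t + h] 0^']).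

Definition derive_time (R : realType) (f : R -> R) (t : R) : R :=
  lim (diff_quot_time f t h @[h --> within [set h | 0 <= t + h] 0^']).

Definition basis_vec (R : realType) (n : nat) (j : 'I_n) : 'rV[R]_n :=
  delta_mx 0 j.

Definition has_partial (R : realType) (n : nat) (g : 'rV[R]_n -> R) (j : 'I_n)
  (x : 'rV[R]_n) : Prop := derivable g x (basis_vec R j).

Definition partial (R : realType) (n : nat) (g : 'rV[R]_n -> R) (j : 'I_n)
  (x : 'rV[R]_n) : R := 'D_(basis_vec R j) g x.

(* Row i, column j holds the derivative of the i-th component with respect to
   the j-th variable; the library's 'J is the transpose of this matrix. *)
Definition jacobian_mx (R : realType) (n : nat) (f : 'rV[R]_n -> 'rV[R]_n)
  (x : 'rV[R]_n) : 'M[R]_n :=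
  \matrix_(i, j) partial (fun y => f y 0 i) j x.

(* The library norm `|v| on matrices is the max norm, hence these Euclidean
   versions. *)
Definition sqnorm2 (R : realType) (n : nat) (v : 'rV[R]_n) : R :=
  \sum_i v 0 i ^+ 2.

Definition grad_norm (R : realType) (n : nat) (f : 'rV[R]_n -> 'rV[R]_n)
  (x : 'rV[R]_n) : R :=
  Num.sqrt (\sum_i \sum_j jacobian_mx f x i j ^+ 2).

Record C2_bounded (R : realType) (n : nat) (f : 'rV[R]_n -> 'rV[R]_n) : Prop :=
  { C2_partial : forall i j x, has_partial (fun y => f y 0 i) j x ;
    C2_partial2 : forall i j k x,
      has_partial (partial (fun y => f y 0 i) j) k x ;
    C2_cont : continuous f ;
    C2_cont1 : forall i j, continuous (partial (fun y => f y 0 i) j) ;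
    C2_cont2 : forall i j k,
      continuous (partial (partial (fun y => f y 0 i) j) k) ;
    C2_bound : exists M : R, forall x,
      [/\ forall i, `|f x 0 i| <= M,
          forall i j, `|partial (fun y => f y 0 i) j x| <= M &
          forall i j k, `|partial (partial (fun y => f y 0 i) j) k x| <= M] }.

Record scale_factor (R : realType) (a : R -> R) : Prop :=
  { scale_gt0 : forall t : R, 0 <= t -> 0 < a t ;
    scale_derivable : forall t : R, 0 <= t -> derivable_time a t ;
    scale_derivable2 : forall t : R, 0 <= t -> derivable_time (derive_time a) t ;
    scale_init : a 0 = 1 }.

Record assumption_H3 (R : realType) (a : R -> R) : Prop :=
  { H3_velocity : forall t : R, 0 <= t -> 0 < derive_time a t ;
    H3_acceleration : forall t : R, 0 <= t -> derive_time (derive_time a) t < 0 ;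
    H3_growth : exists l C : R, [/\ 0 < l, l <= 2^-1, 0 < C &
      forall t : R, 0 <= t ->
        C^-1 * (1 + t) `^ l <= a t /\ a t <= C * (1 + t) `^ l] }.

Definition slab (R : realType) (n : nat) (T : R) : set (R * 'rV[R]_n) :=
  [set p | 0 <= p.1 < T].
Arguments slab {R} n T _.

(* C^1 up to and including t = 0. *)
Record C1_on_slab (R : realType) (n : nat) (T : R)
    (v : R -> 'rV[R]_n -> 'rV[R]_n) : Prop :=
  { C1_time : forall (t : R) x i, 0 <= t < T ->
      derivable_time (fun s => v s x 0 i) t ;
    C1_space : forall (t : R) x i j, 0 <= t < T ->
      has_partial (fun y => v t y 0 i) j x ;
    C1_cont : {within slab n T, continuous (fun p => v p.1 p.2)} ;
    C1_cont_time : forall i, {within slab n T, continuous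
      (fun p : R * 'rV[R]_n => derive_time (fun s => v s p.2 0 i) p.1)} ;
    C1_cont_space : forall i j, {within slab n T, continuous
      (fun p : R * 'rV[R]_n => partial (fun y => v p.1 y 0 i) j p.2)} }.

Record classical_solution (R : realType) (n : nat) (c : R) (a : R -> R)
    (u0 : 'rV[R]_n -> 'rV[R]_n) (T : R)
    (v : R -> 'rV[R]_n -> 'rV[R]_n) : Prop :=
  { sol_C1 : C1_on_slab T v ;
    sol_eq : forall (t : R) x i, 0 <= t < T ->
      derive_time (fun s => v s x 0 i) t
      + \sum_j v t x 0 j / a t * partial (fun y => v t y 0 i) j x
      + derive_time a t / a t * v t x 0 i
      - derive_time a t / a t * (sqnorm2 (v t x) / c ^+ 2) * v t x 0 i = 0 ;
    sol_init : forall x, v 0 x = u0 x }.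

(* Maximality of T is not part of the notion: the gradient may blow up along a
   sequence of points escaping to infinity. The supremum is taken in \bar R. *)
Definition gradient_blows_up (R : realType) (n : nat) (T : R)
    (v : R -> 'rV[R]_n -> 'rV[R]_n) : Prop :=
  ereal_sup [set (grad_norm (v t) x)%:E | x in [set: 'rV[R]_n]] @[t --> T^'-]
    --> +oo%E.

(* Main.v *)
Require Import Defs.
From HB Require Import structures.
From mathcomp Require Import all_boot all_order all_fingroup all_algebra.
From mathcomp Require Import all_classical all_reals all_analysis.
From mathcomp Require Import ring lra.
Import Order.TTheory GRing.Theory Num.Theory.
Import numFieldNormedType.Exports.
Local Open Scope classical_set_scope.
Local Open Scope ring_scope.

Set Implicit Arguments.
Unset Strict Implicit.
Unset Printing Implicit Defensive.

(** Along the trajectories [dx/dt = v/a] the equation is an ordinary differential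
    equation that preserves the direction of [v] and can be integrated: with
    [rho = eps^2 |v0|^2 / c^2] and [theta = 1 - a^-2], the particle that starts
    from [alpha] has velocity [eps v0 (1 - rho theta)^(-1/2) / a] and position
    [alpha + eps v0 disp], where [disp] is the time integral of
    [a^-2 (1 - rho theta)^(-1/2)].  This is the flow [pos], with velocity [vel].

    Its Jacobian matrix is [1 + eps W D], where [D] is the Jacobian matrix of [v0]
    and [W = disp + k v0^T v0] with [k >= 0] ([fo_pos]).  Since [a] grows at most
    like [(1+t)^(1/2)], [disp] diverges ([disp_unbounded]), so at a point where
    [det D < 0] the determinant of [1 + eps W D], which is 1 at time 0, becomes
    negative ([det_eventually_lt0], [jac_det_lt0]).  Hence there is a time
    [T] such that the determinant has a positive lower bound on every compact part
    of [[0, T)], while its infimum over space tends to 0 as [t] tends to [T]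
    ([critical_time]).

    Before [T] the flow is a bijection of space with a Lipschitz inverse, which is
    continued in time by contractions ([path_inversion]); transporting [vel] by
    this inverse gives a classical solution ([sol_classical]).  It is the only
    one: on the explicit trajectories, the difference between another solution and
    [vel] satisfies a linear homogeneous system ([sol_on_characteristic]).

    The velocity has Jacobian matrix [eps Q D] in the variable [alpha], where
    [Q = q + r v0^T v0] with [q > 0] and [r >= 0] commutes with [W].  Eliminating
    [D] gives [(Q - W grad v) (1 + eps W D) = Q] ([jacobian_relation]).  The
    determinant of [Q] stays away from 0, while that of [1 + eps W D] has infimum
    tending to 0 as [t] tends to [T], so [grad v] is unbounded
    ([sol_jac_unbounded]).

    Derivatives are handled in Caratheodory's form ([first_order]). *)

(** * First-order expansions along a filter *)

Section LimitsOfSums.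
Variables (R : realType) (T : Type) (F : set_system T).
Context {FF : Filter F}.

Lemma cvg_bigsum (I : Type) (r : seq I) (P : pred I) (f : I -> T -> R)
    (l : I -> R) :
  (forall i, P i -> f i p @[p --> F] --> l i) ->
  \sum_(i <- r | P i) f i p @[p --> F] --> \sum_(i <- r | P i) l i.
Proof. by move=> fl; apply: cvg_big => //; exact: add_continuous. Qed.

Lemma cvg_bigprod (I : Type) (r : seq I) (P : pred I) (f : I -> T -> R)
    (l : I -> R) :
  (forall i, P i -> f i p @[p --> F] --> l i) ->
  \prod_(i <- r | P i) f i p @[p --> F] --> \prod_(i <- r | P i) l i.
Proof. by move=> fl; apply: cvg_big => //; exact: mul_continuous. Qed.

Lemma cvg_near_eq (f g : T -> R) (l : R) :
  (\forall p \near F, f p = g p) -> g p @[p --> F] --> l ->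
  f p @[p --> F] --> l.
Proof.
move=> fg gl; apply: cvg_trans gl; apply: near_eq_cvg.
by apply: filterS fg => p /esym.
Qed.

Lemma cvg_det n (M : T -> 'M[R]_n) (A : 'M[R]_n) :
  (forall i j, M p i j @[p --> F] --> A i j) ->
  \det (M p) @[p --> F] --> \det A.
Proof.
move=> MA; rewrite /determinant; apply: cvg_bigsum => s _.
by apply: cvgMl_tmp; apply: cvg_bigprod => i _; exact: MA.
Qed.

Lemma cvg_invmx n (M : T -> 'M[R]_n) (A : 'M[R]_n) :
  (forall i j, M p i j @[p --> F] --> A i j) -> \det A != 0 ->
  forall i j, (invmx (M p)) i j @[p --> F] --> (invmx A) i j.
Proof.
move=> MA A0 i j; have dM := cvg_det MA.
have M0 : \forall p \near F, \det (M p) != 0.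
  exact: cvgr_neq0 dM A0.
rewrite /invmx unitmxE unitfE A0 !mxE.
apply: (@cvg_near_eq _ (fun p => (\det (M p))^-1 * (\adj (M p)) i j)).
  by apply: filterS M0 => p p0; rewrite unitmxE unitfE p0 !mxE.
apply: cvgM; first exact: (cvgV A0 dM).
under eq_fun do rewrite mxE /cofactor.
apply: cvgMl_tmp.
by apply: cvg_det => k l; under eq_fun do rewrite !mxE; rewrite !mxE; exact: MA.
Qed.

End LimitsOfSums.

(** This is Caratheodory's form of differentiability:
    [g = g0 + \sum_k d k * L k + o(d)], where the remainder is absorbed in
    coefficients [Phi k] that converge to [L k].  Remainders never have to be
    estimated, so the chain rule and the inverse function rule are mere
    rearrangements of limits; and as the filter is arbitrary, one-sided
    derivatives at the initial time need no special treatment. *)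
Definition first_order (R : realType) (T : Type) (F : set_system T)
    (K : finType) (d : K -> T -> R) (g : T -> R) (g0 : R) (L : K -> R) : Prop :=
  exists2 Phi : K -> T -> R, (forall k, Phi k p @[p --> F] --> L k) &
    \forall p \near F, g p = g0 + \sum_k d k p * Phi k p.

Section FirstOrder.
Variables (R : realType) (T : Type) (F : set_system T).
Context {FF : Filter F}.
Variables (K : finType) (d : K -> T -> R).
Local Notation fo := (first_order F d).
Implicit Types (g h : T -> R) (a b : R) (L M : K -> R).

Lemma fo_eq g h a b L M : (\forall p \near F, g p = h p) -> a = b ->
  L =1 M -> fo g a L -> fo h b M.
Proof.
move=> gh <- LM [Phi PL gE]; exists Phi => [k|]; first by rewrite -LM.
by apply: filterS2 gE gh => p -> ->.
Qed.

Lemma fo_cst (c : R) : fo (fun=> c) c (fun=> 0).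
Proof.
exists (fun=> fun=> 0) => [k|]; first exact: cvg_cst.
by apply: nearW => p; rewrite big1 ?addr0 // => k _; rewrite mulr0.
Qed.

Lemma fo_coord k : fo (d k) 0 (fun j => (j == k)%:R).
Proof.
exists (fun j => fun=> (j == k)%:R) => [j|]; first exact: cvg_cst.
apply: nearW => p; rewrite (bigD1 k) //= eqxx mulr1 big1 ?addr0 ?add0r //.
by move=> j /negPf ->; rewrite mulr0.
Qed.

Lemma foD g h a b L M : fo g a L -> fo h b M ->
  fo (fun p => g p + h p) (a + b) (fun k => L k + M k).
Proof.
move=> [P PL gE] [Q QM hE]; exists (fun k p => P k p + Q k p) => [k|].
  exact: cvgD.
apply: filterS2 gE hE => p -> ->; under [in RHS]eq_bigr do rewrite mulrDr.
by rewrite big_split /= addrACA.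
Qed.

(** Differentiating a composite means substituting, into an expansion whose
    increments [u j] are functions themselves, the expansions of those
    increments. *)
Lemma fo_subst (J : finType) (u S : J -> T -> R) (s : J -> R) (M : J -> K -> R)
    g a :
  (forall j, fo (u j) 0 (M j)) -> (forall j, S j p @[p --> F] --> s j) ->
  (\forall p \near F, g p = a + \sum_j u j p * S j p) ->
  fo g a (fun k => \sum_j s j * M j k).
Proof.
move=> uM Ss gE.
have /choice[P PE] j : exists P : K -> T -> R,
    (forall k, P k p @[p --> F] --> M j k) /\
    (\forall p \near F, u j p = \sum_k d k p * P k p).
  have [P PM uE] := uM j; exists P; split => //.
  by apply: filterS uE => p ->; rewrite add0r.
exists (fun k p => \sum_j S j p * P j k p) => [k|].
  by apply: cvg_bigsum => j _; apply: cvgM => //; exact: (PE j).1.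
have uE : \forall p \near F, forall j, u j p = \sum_k d k p * P j k p.
  by apply: filter_forall => j; exact: (PE j).2.
apply: filterS2 gE uE => p -> uE; congr (_ + _).
under eq_bigr => j _ do rewrite uE mulr_suml.
rewrite exchange_big /=; apply: eq_bigr => k _; rewrite mulr_sumr.
by apply: eq_bigr => j _; rewrite mulrAC mulrA.
Qed.

Lemma fo_subst1 (u S : T -> R) (s : R) M g a :
  fo u 0 M -> S p @[p --> F] --> s ->
  (\forall p \near F, g p = a + u p * S p) ->
  fo g a (fun k => s * M k).
Proof.
move=> uM Ss gE.
have A := @fo_subst 'I_1 (fun=> u) (fun=> S) (fun=> s) (fun=> M) g a
  (fun=> uM) (fun=> Ss).
apply: (fo_eq _ (erefl a) _ (A _)); first exact: nearW.
  by move=> k; rewrite big_ord1.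
by apply: filterS gE => p ->; rewrite big_ord1.
Qed.

Lemma foB g a L : fo g a L -> fo (fun p => g p - a) 0 L.
Proof.
move=> gL; apply: fo_eq (foD gL (fo_cst (- a))); first exact: nearW.
  by rewrite subrr.
by move=> k; rewrite addr0.
Qed.

Lemma foZ c g a L : fo g a L -> fo (fun p => c * g p) (c * a) (fun k => c * L k).
Proof.
move=> gL; apply: (fo_subst1 (foB gL)) (cvg_cst c) _.
by apply: nearW => p; ring.
Qed.

Lemma fo_sum (I : finType) (g : I -> T -> R) (a : I -> R) (L : I -> K -> R) :
  (forall i, fo (g i) (a i) (L i)) ->
  fo (fun p => \sum_i g i p) (\sum_i a i) (fun k => \sum_i L i k).
Proof.
move=> gL; apply: (fo_eq _ (erefl _) _ (@fo_subst I
  (fun i p => g i p - a i) (fun=> fun=> 1) (fun=> 1) L _ (\sum_i a i)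
  (fun i => foB (gL i)) (fun=> cvg_cst _) _)); first exact: nearW.
  by move=> k; under eq_bigr do rewrite mul1r.
apply: nearW => p; rewrite -big_split; apply: eq_bigr => i _.
by rewrite /= mulr1 addrC subrK.
Qed.

Hypothesis d0 : forall k, d k p @[p --> F] --> (0 : R).

Lemma fo_cvg g a L : fo g a L -> g p @[p --> F] --> a.
Proof.
move=> [P PL gE]; apply: cvg_near_eq gE _.
rewrite -[a in X in _ --> X]addr0; apply: cvgD; first exact: cvg_cst.
rewrite -[X in _ --> X](_ : \sum_k 0 * L k = 0).
  by apply: cvg_bigsum => k _; exact: cvgM.
by apply: big1 => k _; rewrite mul0r.
Qed.

Lemma foM g h a b L M : fo g a L -> fo h b M ->
  fo (fun p => g p * h p) (a * b) (fun k => b * L k + a * M k).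
Proof.
move=> gL hM; have hc := fo_cvg hM.
have A : fo (fun p => (g p - a) * h p) 0 (fun k => b * L k).
  by apply: (fo_subst1 (foB gL) hc); apply: nearW => p; rewrite add0r.
apply: fo_eq (foD A (foZ a hM)) => //; last by rewrite add0r.
by apply: nearW => p; ring.
Qed.

End FirstOrder.

Section FirstOrderChange.
Variables (R : realType) (T T' : Type) (F : set_system T) (F' : set_system T').
Context {FF : Filter F} {FF' : Filter F'}.
Variables (K K' : finType) (d : K -> T -> R) (d' : K' -> T' -> R).

Lemma fo_chain (gam : T -> T') (M : K' -> K -> R) g g0 L :
  gam p @[p --> F] --> F' ->
  (forall k', first_order F d (fun p => d' k' (gam p)) 0 (M k')) ->
  first_order F' d' g g0 L ->
  first_order F d (fun p => g (gam p)) g0 (fun k => \sum_k' L k' * M k' k).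
Proof.
move=> gamF dM [P PL gE].
apply: (fo_subst (S := fun k p => P k (gam p)) dM).
  by move=> j; apply: (cvg_comp _ _ gamF); exact: PL.
exact: (gamF _ gE).
Qed.

End FirstOrderChange.

(** Implicit differentiation: the increments of the unknowns [y] solve a linear
    system, whose matrix converges to an invertible matrix [A]. *)
Lemma fo_solve (R : realType) (T : Type) (F : set_system T) {FF : Filter F}
    (K : finType) (d : K -> T -> R) n (y r : 'I_n -> T -> R) (y0 : 'I_n -> R)
    (Phi : T -> 'M[R]_n) (A : 'M[R]_n) (L : 'I_n -> K -> R) :
  (forall i j, Phi p i j @[p --> F] --> A i j) -> \det A != 0 ->
  (forall i, first_order F d (r i) 0 (L i)) ->
  (\forall p \near F, forall i, \sum_j Phi p i j * (y j p - y0 j) = r i p) ->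
  forall j, first_order F d (y j) (y0 j) (fun k => \sum_i invmx A j i * L i k).
Proof.
move=> PA A0 rL sys j.
apply: (fo_subst (S := fun i p => invmx (Phi p) j i) rL).
  by move=> i; exact: cvg_invmx.
have P0 : \forall p \near F, \det (Phi p) != 0.
  exact: cvgr_neq0 (cvg_det PA) A0.
apply: filterS2 P0 sys => p P0 sys.
pose dy : 'cV[R]_n := \col_j (y j p - y0 j).
have dyE : invmx (Phi p) *m (Phi p *m dy) = dy.
  by rewrite mulmxA mulVmx ?mul1mx // unitmxE unitfE.
apply/eqP; rewrite addrC -subr_eq; apply/eqP.
have := congr1 (fun m : 'cV_n => m j 0) dyE; rewrite !mxE => <-.
apply: eq_bigr => i _; rewrite mulrC -sys; congr (_ * _).
by rewrite mxE; apply: eq_bigr => k _; rewrite mxE.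
Qed.

(** * Partial derivatives and increments *)

Section RowVectors.
Variables (R : realType) (n : nat).
Implicit Types (v x y : 'rV[R]_n).

Lemma ler_coord_norm v j : `|v 0 j| <= `|v|.
Proof.
rewrite [leRHS]/Num.norm /= mx_normrE.
by apply/bigmax_geP; right; exists (0, j).
Qed.

Lemma norm_le_coord v (c : R) : 0 <= c -> (forall j, `|v 0 j| <= c) -> `|v| <= c.
Proof.
move=> c0 vc; rewrite [leLHS]/Num.norm /= mx_normrE.
by apply/bigmax_leP; split => // -[i j] _ /=; rewrite ord1.
Qed.

Lemma cvg_coord (T : Type) (F : set_system T) {FF : Filter F} (f : T -> 'rV[R]_n)
    v : (forall j, f p 0 j @[p --> F] --> v 0 j) -> f p @[p --> F] --> v.
Proof.
move=> fv; apply/cvgrPdist_le => e e0.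
have : \forall p \near F, forall j, `|v 0 j - f p 0 j| <= e.
  by apply: filter_forall => j; move/cvgrPdist_le : (fv j); apply.
apply: filterS => p fp; apply: norm_le_coord => [|j]; first exact: ltW.
by rewrite !mxE.
Qed.

Lemma coord_cvg (T : Type) (F : set_system T) {FF : Filter F} (f : T -> 'rV[R]_n)
    v j : f p @[p --> F] --> v -> f p 0 j @[p --> F] --> v 0 j.
Proof.
move=> fv.
exact: (cvg_comp f (fun w : 'rV_n => w 0 j) fv (@coord_continuous R 1 n 0 j v)).
Qed.

End RowVectors.

Section Partials.
Variables (R : realType) (n : nat).
Implicit Types (g : 'rV[R]_n -> R) (x y : 'rV[R]_n).

Lemma mvt1 (G dG : R -> R) (a b : R) : (forall r : R, is_derive r 1 G (dG r)) ->
  exists2 c, Num.min a b <= c <= Num.max a b & G b - G a = (b - a) * dG c.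
Proof.
move=> GdG; have cG : continuous G.
  by move=> r; apply: differentiable_continuous; apply/derivable1_diffP.
have [ab|/ltW ba] := leP a b.
  have [c] := MVT_segment ab (fun r _ => GdG r) (continuous_subspaceT cG).
  by rewrite in_itv /= => cab GE; exists c => //; rewrite mulrC.
have [c] := MVT_segment ba (fun r _ => GdG r) (continuous_subspaceT cG).
rewrite in_itv /= => cab GE; exists c => //.
by rewrite -opprB GE mulrC -mulNr opprB.
Qed.

Lemma is_derive_line g j x (r : R) :
  has_partial g j (x + r *: basis_vec R j) ->
  is_derive r 1 (fun s => g (x + s *: basis_vec R j))
    (partial g j (x + r *: basis_vec R j)).
Proof.
set e := basis_vec R j => gd.
have E : (fun h : R => h^-1 *: (((fun s => g (x + s *: e)) \o shift r) (h *: 1)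
    - g (x + r *: e))) =
    (fun h => h^-1 *: ((g \o shift (x + r *: e)) (h *: e) - g (x + r *: e))).
  apply/funext => h /=; congr (_ *: (g _ - _)).
  by rewrite [h *: 1]mulr1 scalerDl addrCA.
split; first by rewrite /derivable E.
by rewrite /derive E.
Qed.

(** Moving from [x] to [y] along one coordinate axis after the other reduces
    the increment of a function of several variables to one-variable mean
    values. *)
Lemma partial_increment g x y : (forall j z, has_partial g j z) ->
  exists2 xi : 'I_n -> 'rV[R]_n, (forall j, `|xi j - x| <= `|y - x|) &
    g y - g x = \sum_j (y 0 j - x 0 j) * partial g j (xi j).
Proof.
move=> gd; pose z k : 'rV[R]_n := \row_j (if (j < k)%N then y 0 j else x 0 j).
have zS (k : 'I_n) : z k.+1 = z k + (y 0 k - x 0 k) *: basis_vec R k.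
  apply/rowP => j; rewrite !mxE /= ltnS leq_eqVlt -val_eqE /=.
  have [/val_inj ->|_] /= := eqVneq (j : nat) k.
    by rewrite ltnn mulr1 addrC subrK.
  by rewrite mulr0 addr0.
have /choice[xi xiP] (k : 'I_n) : exists xi : 'rV[R]_n,
    `|xi - x| <= `|y - x| /\
    g (z k.+1) - g (z k) = (y 0 k - x 0 k) * partial g k xi.
  have [c cab] := mvt1 0 (y 0 k - x 0 k)
    (fun r => is_derive_line (gd k (z k + r *: basis_vec R k))).
  rewrite -zS scale0r addr0 subr0 => gE.
  exists (z k + c *: basis_vec R k); split => //.
  apply: norm_le_coord => // j; apply: le_trans (ler_coord_norm (y - x) j).
  rewrite !mxE /= -val_eqE /=.
  have [/val_inj ->|_] /= := eqVneq (j : nat) k.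
    rewrite ltnn mulr1 addrC addKr.
    case: (leP 0 (y 0 k - x 0 k)) cab => d0 /andP[c1 c2]; first by rewrite !ger0_norm.
    by rewrite !ler0_norm ?lerN2 // ltW.
  by case: ifP; rewrite mulr0 addr0 // subrr normr0.
exists xi => [j|]; first exact: (xiP j).1.
have <- : \sum_(k < n) (g (z k.+1) - g (z k)) = g y - g x.
  rewrite -(big_mkord xpredT (fun k => g (z k.+1) - g (z k))).
  rewrite telescope_sumr //; congr (g _ - g _); apply/rowP => j; rewrite !mxE //.
  by rewrite ltn_ord.
by apply: eq_bigr => k _; exact: (xiP k).2.
Qed.

Lemma partial_lipschitz g (B : R) x y : (forall j z, has_partial g j z) ->
  (forall j z, `|partial g j z| <= B) -> `|g y - g x| <= n%:R * B * `|y - x|.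
Proof.
move=> gd gB; have [xi _ ->] := partial_increment x y gd.
apply: le_trans (ler_norm_sum _ _ _) _.
rewrite -mulrA mulr_natl -[n in _ *+ n]card_ord -sumr_const.
apply: ler_sum => j _; rewrite normrM mulrC ler_pM //.
by have := ler_coord_norm (y - x) j; rewrite !mxE.
Qed.

Definition dspace x (j : 'I_n) y : R := y 0 j - x 0 j.

Lemma cvg_mean_points (T : topologicalType) (F : set_system 'rV[R]_n) {FF : Filter F}
   x (h : 'rV[R]_n -> T) (xi : 'rV[R]_n -> 'rV[R]_n) :
  F --> x -> (forall y, `|xi y - x| <= `|y - x|) -> h y @[y --> x] --> h x ->
  h (xi y) @[y --> F] --> h x.
Proof.
move=> Fx xiP hx; apply: (cvg_comp xi h) hx.
apply/cvgrPdist_le => e e0; move/cvgrPdist_le : Fx => /(_ e e0).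
apply: filterS => y /=; rewrite (distrC x y) (distrC x (xi y)).
exact: le_trans.
Qed.

(** The intermediate points of [partial_increment] tend to [x] with the endpoint,
    so the partial derivatives there are coefficients of the required kind. *)
Lemma fo_of_partial g x : (forall j z, has_partial g j z) ->
  (forall j, partial g j y @[y --> x] --> partial g j x) ->
  first_order (nbhs x) (dspace x) g (g x) (partial g ^~ x).
Proof.
move=> gd gc; have /choice[xi xiP] y := 
  let: ex_intro2 xi A B := partial_increment x y gd in
  ex_intro (fun xi : 'I_n -> 'rV[R]_n => (forall j, `|xi j - x| <= `|y - x|) /\
    g y - g x = \sum_j (y 0 j - x 0 j) * partial g j (xi j)) xi (conj A B).
exists (fun j y => partial g j (xi y j)) => [j|].
  by apply: (@cvg_mean_points _ _ _ x _ (xi ^~ j)) (gc j) => // y; exact: (xiP y).1.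
by apply: nearW => y; rewrite -(xiP y).2 addrC subrK.
Qed.

Lemma partial_of_fo g x L j :
  first_order (nbhs x) (dspace x) g (g x) L ->
  has_partial g j x /\ partial g j x = L j.
Proof.
move=> [Phi PL gE].
have line : (fun h : R => h *: basis_vec R j + x) h @[h --> 0^'] --> x.
  rewrite -[x in X in _ --> X]add0r -(scale0r (basis_vec R j)).
  apply: cvgD; last exact: cvg_cst; apply: cvgZr_tmp.
  exact: cvg_within.
have : h^-1 *: ((g \o shift x) (h *: basis_vec R j) - g x) @[h --> 0^'] --> L j.
  apply: (@cvg_near_eq _ _ _ _ _
    (fun h : R => Phi j (h *: basis_vec R j + x))); last first.
    exact: (cvg_comp _ _ line (PL j)).
  have hn0 : \forall h \near (0 : R)^', h != 0 by exact: nbhs_dnbhs_neq.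
  have := line _ gE; apply: filterS2 hn0 => h h0 /= ->.
  rewrite addrAC subrr add0r (bigD1 j) //= big1 ?addr0; last first.
    by move=> i ij; rewrite /dspace !mxE /= (negPf ij) mulr0 add0r subrr mul0r.
  rewrite /dspace !mxE !eqxx mulr1 addrK.
  by rewrite [_ *: _]mulrA mulVf // mul1r.
move=> gL; split; first by apply/cvg_ex; exists (L j).
exact: cvg_lim gL.
Qed.

End Partials.

(** * Derivatives with respect to time *)

Section TimeDerivative.
Variable R : realType.
Implicit Types (f : R -> R) (t L : R).

Definition is_dtime f t L : Prop :=
  diff_quot_time f t h @[h --> within [set h | 0 <= t + h] 0^'] --> L.

Definition dtime t (k : 'I_1) (s : R) : R := s - t.

Definition nbhs_ge0 t : set_system R := within [set s | 0 <= s] (nbhs t).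

#[global] Instance nbhs_ge0_filter t : Filter (nbhs_ge0 t).
Proof. exact: within_filter. Qed.

Lemma dtime_filter_proper t : 0 <= t ->
  ProperFilter (within [set h | 0 <= t + h] (0 : R)^').
Proof.
move=> t0; split; last exact: within_filter.
move=> /nbhs_ballP[e /= e0 eb]; have e2 : 0 < e / 2 by rewrite divr_gt0.
apply: (eb (e / 2)); last first.
- by rewrite /= addr_ge0 // ltW.
- by rewrite /= gt_eqF.
by rewrite /ball /= sub0r normrN gtr0_norm // gtr_pMr // invf_lt1 // ltr1n.
Qed.

Lemma is_dtimeE f t L : 0 <= t -> is_dtime f t L ->
  derivable_time f t /\ derive_time f t = L.
Proof.
move=> t0 fL; have FF := dtime_filter_proper t0.
by split; [apply/cvg_ex; exists L|exact: cvg_lim fL].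
Qed.

Lemma derivable_timeP f t : derivable_time f t -> is_dtime f t (derive_time f t).
Proof. by []. Qed.

Lemma fo_of_dtime f t L : is_dtime f t L ->
  first_order (nbhs_ge0 t) (dtime t) f (f t) (fun=> L).
Proof.
move=> fL.
exists (fun _ s => if s == t then L else diff_quot_time f t (s - t)); last first.
  apply: nearW => s; rewrite big_ord1 /dtime /diff_quot_time.
  have [->|st] := eqVneq s t; first by rewrite subrr mul0r addr0.
  by rewrite addrCA subrr addr0 mulrC divfK ?subr_eq0 // addrCA subrr addr0.
move=> _; apply/cvgrPdist_le => e e0.
have st0 : (fun s => s - t) s @[s --> t] --> (0 : R).
  by rewrite -(subrr t); apply: cvgB; [exact: cvg_id|exact: cvg_cst].
have fLe : \forall s \near t, s - t != 0 -> 0 <= t + (s - t) ->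
    `|L - diff_quot_time f t (s - t)| <= e.
  exact: st0 _ ((cvgrPdist_le _ _).1 fL e e0).
suff : \forall s \near t, 0 <= s ->
    `|L - (if s == t then L else diff_quot_time f t (s - t))| <= e by [].
apply: filterS fLe => s /= fs s0; case: eqVneq => st.
  by rewrite subrr normr0 ltW.
by apply: fs; rewrite ?subr_eq0 //= addrCA subrr addr0.
Qed.

Lemma dtime_of_fo f t L : first_order (nbhs_ge0 t) (dtime t) f (f t) (fun=> L) ->
  is_dtime f t L.
Proof.
move=> [Phi PL fE].
have th : (fun h => t + h) h @[h --> within [set h | 0 <= t + h] (0 : R)^']
    --> nbhs_ge0 t.
  move=> A [e /= e0 eA]; exists e => //= h /= he h0 th0; apply: eA => //=.
  by rewrite opprD addrA subrr.
apply: (@cvg_near_eq _ _ _ _ _ (fun h => Phi ord0 (t + h))); last first.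
  exact: (cvg_comp _ _ th (PL ord0)).
have hn0 : \forall h \near within [set h | 0 <= t + h] (0 : R)^', h != 0.
  have h0 : \forall h \near (0 : R)^', h != 0 by exact: nbhs_dnbhs_neq.
  by apply: filterS h0 => h.
have := th _ fE; apply: filterS2 hn0 => h h0 /= fh.
rewrite /diff_quot_time fh big_ord1 /dtime addrAC subrr add0r addrAC subrr add0r.
by rewrite mulrAC mulfV // mul1r.
Qed.

Lemma dtime0 t k : dtime t k s @[s --> nbhs_ge0 t] --> (0 : R).
Proof.
rewrite -(subrr t).
by apply: cvgB; [exact: cvg_within|exact: cvg_cst].
Qed.

Lemma dtime_cvg f t L : is_dtime f t L -> f s @[s --> nbhs_ge0 t] --> f t.
Proof. by move=> /fo_of_dtime; apply: fo_cvg => k; exact: dtime0. Qed.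

Lemma is_dtime_derive f t L : 0 < t -> is_dtime f t L -> is_derive t 1 f L.
Proof.
move=> t0 fL; suff : h^-1 *: ((f \o shift t) (h *: 1) - f t) @[h --> 0^'] --> L.
  move=> dL; split; last exact: cvg_lim dL.
  by apply/cvg_ex; exists L.
have -> : (fun h : R => h^-1 *: ((f \o shift t) (h *: 1) - f t)) =
    diff_quot_time f t.
  by apply/funext => h; rewrite /diff_quot_time /= [h *: 1]mulr1 (addrC h) [RHS]mulrC.
have FF := dtime_filter_proper (ltW t0).
apply/cvgrPdist_le => e e0.
have fLe : \forall h \near (0 : R)^', 0 <= t + h -> `|L - diff_quot_time f t h| <= e.
  exact: (cvgrPdist_le _ _).1 fL e e0.
have h0 : \forall h \near (0 : R)^', 0 <= t + h.
  exists t => //= h; rewrite /ball_ /= sub0r normrN => /ltr_normlP[+ _] _.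
  by rewrite ltrNl -lerBlDl sub0r => /ltW.
by apply: filterS2 h0 fLe => h h0; apply.
Qed.

Lemma dtime_of_derive f t L : is_derive t 1 f L -> is_dtime f t L.
Proof.
move=> [df <-]; apply: (@cvg_trans _ (diff_quot_time f t h @[h --> 0^'])).
  by apply: cvg_app; exact: cvg_within.
rewrite (_ : diff_quot_time f t =
    (fun h : R => h^-1 *: ((f \o shift t) (h *: 1) - f t))); first exact: df.
by apply/funext => h; rewrite /diff_quot_time /= [h *: 1]mulr1 (addrC h) [LHS]mulrC.
Qed.

(** At the initial time only the right derivative is available; the mean value
    theorem merely needs continuity there. *)
Lemma time_mvt f (df : R -> R) (a b : R) : 0 <= a -> a <= b ->
  (forall t, a <= t <= b -> is_dtime f t (df t)) ->
  exists2 c, a <= c <= b & f b - f a = (b - a) * df c.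
Proof.
move=> a0 ab fdf; have [||c] := @MVT_segment R f df a b ab.
- move=> s; rewrite in_itv /= => /andP[ac cb]; apply: is_dtime_derive.
    exact: le_lt_trans a0 ac.
  by apply: fdf; rewrite !ltW.
- apply/subspace_continuousP => t /=; rewrite in_itv /= => tab.
  apply: cvg_trans (dtime_cvg (fdf t tab)); apply: cvg_app.
  apply: within_subset => s /=; rewrite in_itv /= => /andP[+ _].
  exact: le_trans.
by rewrite in_itv /= mulrC => cab ->; exists c.
Qed.

Lemma time_ge0_le f (df : R -> R) (a b : R) : 0 <= a -> a <= b ->
  (forall t, a <= t <= b -> is_dtime f t (df t)) ->
  (forall t, a <= t <= b -> 0 <= df t) -> f a <= f b.
Proof.
move=> a0 ab fdf df0; have [c cab fE] := time_mvt a0 ab fdf.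
by rewrite -subr_ge0 fE mulr_ge0 ?subr_ge0 // df0.
Qed.

Lemma time_lipschitz f (df : R -> R) (a b B : R) : 0 <= a -> 0 <= b ->
  (forall t, 0 <= t -> is_dtime f t (df t)) ->
  (forall t, 0 <= t -> `|df t| <= B) -> `|f b - f a| <= B * `|b - a|.
Proof.
move=> a0 b0 fdf dfB; wlog ab : a b a0 b0 / a <= b.
  move=> wl; have [ab|/ltW ba] := leP a b; first exact: wl.
  by rewrite distrC (distrC b); exact: wl.
have [|c /andP[ac _] ->] := @time_mvt f df a b a0 ab.
  by move=> t /andP[at' _]; apply: fdf; exact: le_trans at'.
by rewrite normrM mulrC ler_wpM2r // dfB // (le_trans a0).
Qed.

Lemma dtime_cst (c t : R) : is_dtime (fun=> c) t 0.
Proof. exact/dtime_of_fo/fo_cst. Qed.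

Lemma dtimeD f g t L M : is_dtime f t L -> is_dtime g t M ->
  is_dtime (fun s => f s + g s) t (L + M).
Proof.
by move=> /fo_of_dtime fL /fo_of_dtime gM; apply: dtime_of_fo; exact: foD.
Qed.

Lemma dtimeM f g t L M : is_dtime f t L -> is_dtime g t M ->
  is_dtime (fun s => f s * g s) t (g t * L + f t * M).
Proof.
move=> /fo_of_dtime fL /fo_of_dtime gM; apply: dtime_of_fo.
by apply: foM => // k; exact: dtime0.
Qed.

Lemma dtimeZ c f t L : is_dtime f t L -> is_dtime (fun s => c * f s) t (c * L).
Proof. by move=> /fo_of_dtime fL; apply: dtime_of_fo; exact: foZ. Qed.

Lemma dtimeB f g t L M : is_dtime f t L -> is_dtime g t M ->
  is_dtime (fun s => f s - g s) t (L - M).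
Proof.
move=> fL /(dtimeZ (c := -1)) gM; have := dtimeD fL gM; rewrite mulN1r.
by under eq_fun do rewrite mulN1r.
Qed.

Lemma dtime_sum (I : finType) (f : I -> R -> R) (L : I -> R) t :
  (forall i, is_dtime (f i) t (L i)) ->
  is_dtime (fun s => \sum_i f i s) t (\sum_i L i).
Proof.
by move=> fL; apply: dtime_of_fo; apply: fo_sum => i; exact: fo_of_dtime.
Qed.

(** A continuous function on the line has a primitive on the half-line; the
    origin of integration is moved to -1 so that 0 is an interior point. *)
Lemma primitive_exists f : continuous f ->
  {F : R -> R | F 0 = 0 & forall t, 0 <= t -> is_dtime F t (f t)}.
Proof.
move=> cf; pose G (t : R) := (\int[lebesgue_measure]_(s in `[-1, t]) f s)%R.
exists (fun t => G t - G 0) => [|t t0]; first by rewrite subrr.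
have t1 : -1 < t :> R by rewrite (lt_le_trans _ t0) // ltrN10.
have [||dG GE] := @continuous_FTC1_closed R f (-1) t (t + 1) _ _ t1 (cf t).
- by rewrite ltrDl.
- apply: continuous_compact_integrable; first exact: segment_compact.
  exact: continuous_subspaceT.
rewrite -[f t]subr0; apply: dtimeB; last exact: dtime_cst.
by apply: dtime_of_derive; split; rewrite // -derive1E.
Qed.

(** The value [f] is a dummy for discontinuous functions. *)
Definition primitive f : R -> R :=
  if pselect (continuous f) is left cf then sval (primitive_exists cf) else f.

End TimeDerivative.

(** * Expansions in space-time *)

Section Slab.
Variables (R : realType) (n : nat) (T : R).
Implicit Types (g : R -> 'rV[R]_n -> R) (t : R) (x : 'rV[R]_n).

Lemma sum_option (I : finType) (f : option I -> R) :
  \sum_k f k = f None + \sum_i f (Some i).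
Proof.
rewrite (bigD1 None) //=; congr (_ + _).
rewrite (reindex_omap Some id) /=; last by case.
by apply: eq_bigl => i; rewrite eqxx.
Qed.

(** The index [None] stands for time. *)
Definition dslab t x (k : option 'I_n) (p : R * 'rV[R]_n) : R :=
  if k is Some j then p.2 0 j - x 0 j else p.1 - t.

Definition nbhs_slab t x : set_system (R * 'rV[R]_n) :=
  within (slab n T) (nbhs (t, x)).

#[global] Instance nbhs_slab_filter t x : Filter (nbhs_slab t x).
Proof. exact: within_filter. Qed.

Lemma cvg_nbhs_slab (U : Type) (F : set_system U) {FF : Filter F}
    (h1 : U -> R) (h2 : U -> 'rV[R]_n) t x :
  h1 u @[u --> F] --> t -> h2 u @[u --> F] --> x ->
  (\forall u \near F, 0 <= h1 u < T) ->
  (h1 u, h2 u) @[u --> F] --> nbhs_slab t x.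
Proof.
move=> h1t h2x hT A wA.
have hA : \forall u \near F, slab n T (h1 u, h2 u) -> A (h1 u, h2 u).
  exact: (cvg_pair h1t h2x wA).
suff : \forall u \near F, A (h1 u, h2 u) by [].
by apply: filterS2 hT hA => u uT; apply.
Qed.

Lemma nbhs_slab_in t x : \forall p \near nbhs_slab t x, 0 <= p.1 < T.
Proof. exact: withinT. Qed.

Lemma nbhs_slab_fst t x : p.1 @[p --> nbhs_slab t x] --> t.
Proof.
apply: (@cvg_trans _ (p.1 @[p --> nbhs (t, x)])); last exact: cvg_fst.
by apply: cvg_app; exact: cvg_within.
Qed.

Lemma nbhs_slab_snd t x : p.2 @[p --> nbhs_slab t x] --> x.
Proof.
apply: (@cvg_trans _ (p.2 @[p --> nbhs (t, x)])); last exact: cvg_snd.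
by apply: cvg_app; exact: cvg_within.
Qed.

Lemma dslab0 t x k : dslab t x k p @[p --> nbhs_slab t x] --> (0 : R).
Proof.
case: k => [j|]; rewrite /dslab.
  rewrite -(subrr (x 0 j)).
  exact: (cvgB (coord_cvg (j := j) (@nbhs_slab_snd t x))
    (cvg_cst (x 0 j))).
rewrite -(subrr t).
exact: (cvgB (@nbhs_slab_fst t x) (cvg_cst t)).
Qed.

(** The increment is split into a time increment at the new position, to which the
    mean value theorem applies, and a space increment at the old time; the
    coefficients converge because the partial derivatives are jointly continuous
    at the base point. *)
Lemma fo_slab g t x : 0 <= t < T ->
  (forall s y, 0 <= s < T -> derivable_time (g ^~ y) s) ->
  (forall j y, has_partial (g t) j y) ->
  derive_time (g ^~ p.2) p.1 @[p --> nbhs_slab t x] --> derive_time (g ^~ x) t ->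
  (forall j, partial (g p.1) j p.2 @[p --> nbhs_slab t x] --> partial (g t) j x) ->
  first_order (nbhs_slab t x) (dslab t x) (fun p => g p.1 p.2) (g t x)
    (fun k => if k is Some j then partial (g t) j x else derive_time (g ^~ x) t).
Proof.
move=> /andP[t0 tT] gt gx ct cx.
have /choice[xi xiP] y :=
  let: ex_intro2 xi A B := partial_increment x y gx in
  ex_intro (fun xi : 'I_n -> 'rV[R]_n => (forall j, `|xi j - x| <= `|y - x|) /\
    g t y - g t x = \sum_j (y 0 j - x 0 j) * partial (g t) j (xi j))
    xi (conj A B).
have /choice[tau tauP] (p : R * 'rV[R]_n) : exists tau : R, 0 <= p.1 < T ->
    [/\ 0 <= tau < T, `|tau - t| <= `|p.1 - t| &
      g p.1 p.2 - g t p.2 = (p.1 - t) * derive_time (g ^~ p.2) tau].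
  have [/andP[p0 pT]|] := boolP (0 <= p.1 < T); last by exists 0.
  have [tp|/ltW pt] := leP t p.1.
    have [s /andP[s1 s2]|c /andP[c1 c2] gE] :=
        @time_mvt R (g ^~ p.2) (derive_time (g ^~ p.2)) t p.1 t0 tp.
      by apply/derivable_timeP/gt; rewrite (le_trans t0) // (le_lt_trans s2).
    exists c => _; split => //; first by rewrite (le_trans t0) //= (le_lt_trans c2).
    by rewrite !ger0_norm ?subr_ge0 // lerB.
  have [s /andP[s1 s2]|c /andP[c1 c2] gE] :=
      @time_mvt R (g ^~ p.2) (derive_time (g ^~ p.2)) p.1 t p0 pt.
    by apply/derivable_timeP/gt; rewrite (le_trans p0) // (le_lt_trans s2).
  exists c => _; split; first by rewrite (le_trans p0) //= (le_lt_trans c2).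
    by rewrite !ler0_norm ?subr_le0 // lerN2 lerB.
  by rewrite -opprB gE -mulNr opprB.
exists (fun k p => if k is Some j then partial (g t) j (xi p.2 j)
                   else derive_time (g ^~ p.2) (tau p)); last first.
  apply: filterS (nbhs_slab_in t x) => p pT.
  rewrite sum_option /= -(xiP p.2).2.
  by have [_ _ <-] := tauP p pT; ring.
case=> [j|].
  apply: (cvg_comp (fun p => (t, xi p.2 j))
    (fun p : R * 'rV[R]_n => partial (g p.1) j p.2)) (cx j).
  apply: cvg_nbhs_slab; first exact: cvg_cst; last first.
    by apply: nearW => _; rewrite t0.
  apply/cvgrPdist_le => e e0.
  apply: filterS (cvgr_distC_le _ _ (@nbhs_slab_snd t x) _ e0) => p.
  by rewrite (distrC x); apply: le_trans; exact: (xiP p.2).1.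
apply: (cvg_comp (fun p => (tau p, p.2))
    (fun p : R * 'rV[R]_n => derive_time (g ^~ p.2) p.1)) ct.
apply: cvg_nbhs_slab; last 2 first.
- exact: nbhs_slab_snd.
- by apply: filterS (nbhs_slab_in t x) => p pT; have [] := tauP p pT.
apply/cvgrPdist_le => e e0.
apply: filterS2 (nbhs_slab_in t x) (cvgr_distC_le _ _ (@nbhs_slab_fst t x) _ e0).
by move=> p pT; rewrite (distrC t); apply: le_trans; have [] := tauP p pT.
Qed.

Lemma fo_slab_space g t x L : 0 <= t < T ->
  first_order (nbhs_slab t x) (dslab t x) (fun p => g p.1 p.2) (g t x) L ->
  first_order (nbhs x) (dspace x) (g t) (g t x) (fun j => L (Some j)).
Proof.
move=> tT gL.
have gam : (t, y) @[y --> x] --> nbhs_slab t x.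
  by apply: (@cvg_nbhs_slab _ (nbhs x) _ (fun=> t) id);
    [exact: cvg_cst|exact: cvg_id|exact: nearW].
pose M (k : option 'I_n) (j : 'I_n) : R := (k == Some j)%:R.
have dM k : first_order (nbhs x) (dspace x) (fun y => dslab t x k (t, y)) 0 (M k).
  case: k => [j|]; last first.
    by apply: fo_eq (fo_cst _ 0) => //; apply: nearW => y; rewrite /= subrr.
  apply: fo_eq (fo_coord _ j) => //; first exact: nearW.
  by move=> k; rewrite /M eq_sym.
apply: fo_eq (fo_chain gam dM gL) => //; first exact: nearW.
move=> j; rewrite sum_option mulr0 add0r (bigD1 j) //= /M eqxx mulr1.
by rewrite big1 ?addr0 // => i ij; rewrite (inj_eq Some_inj) (negPf ij) mulr0.
Qed.

Lemma fo_slab_time g t x L : 0 <= t < T ->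
  first_order (nbhs_slab t x) (dslab t x) (fun p => g p.1 p.2) (g t x) L ->
  is_dtime (g ^~ x) t (L None).
Proof.
move=> /andP[t0 tT] gL.
have gam : (s, x) @[s --> nbhs_ge0 t] --> nbhs_slab t x.
  apply: (@cvg_nbhs_slab _ (nbhs_ge0 t) _ id (fun=> x)).
  - exact: cvg_within.
  - exact: cvg_cst.
  have sT : \forall s \near t, s < T by exact: lt_nbhsl.
  by apply: filterS sT => s sT /= s0; rewrite s0.
pose M (k : option 'I_n) (j : 'I_1) : R := (k == None)%:R.
have dM k : first_order (nbhs_ge0 t) (dtime t) (fun s => dslab t x k (s, x)) 0 (M k).
  case: k => [j|].
    by apply: fo_eq (fo_cst _ 0) => //; apply: nearW => s; rewrite /= subrr.
  apply: fo_eq (fo_coord _ ord0) => //; first exact: nearW.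
  by move=> j; rewrite ord1.
apply: dtime_of_fo; apply: fo_eq (fo_chain gam dM gL) => //; first exact: nearW.
by move=> j; rewrite sum_option mulr1 big1 ?addr0 // => i _; rewrite mulr0.
Qed.

End Slab.

(** * Determinants *)

Section Determinants.
Variables (R : realType) (n : nat).
Implicit Types (A : 'M[R]_n) (v : 'rV[R]_n).

(** The constant need not be sharp: it only has to depend on the bound [B] and on
    the number of factors. *)
Lemma prod_lipschitz (I : eqType) (r : seq I) (f g : I -> R) (B e : R) :
  1 <= B -> 0 <= e -> (forall i, `|f i| <= B) -> (forall i, `|g i| <= B) ->
  (forall i, `|f i - g i| <= e) ->
  `|\prod_(i <- r) f i - \prod_(i <- r) g i| <= (size r)%:R * B ^+ size r * e.
Proof.
move=> B1 e0 fB gB fg; have B0 : 0 <= B by exact: le_trans B1.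
elim: r => [|i r IH]; first by rewrite !big_nil subrr normr0 mul0r mul0r.
rewrite !big_cons /=.
set Pf := \prod_(j <- r) f j; set Pg := \prod_(j <- r) g j.
have PfB : `|Pf| <= B ^+ size r.
  rewrite /Pf; elim: (r) => [|j s IHs]; first by rewrite big_nil normr1.
  by rewrite big_cons normrM /= exprS ler_pM.
have -> : f i * Pf - g i * Pg = (f i - g i) * Pf + g i * (Pf - Pg) by ring.
apply: le_trans (ler_normD _ _) _; rewrite !normrM.
have m1 : `|f i - g i| * `|Pf| <= e * B ^+ (size r).+1.
  apply: ler_pM => //; apply: le_trans PfB _.
  by rewrite exprS ler_peMl // exprn_ge0.
have m2 : `|g i| * `|Pf - Pg| <= B * ((size r)%:R * B ^+ size r * e).
  exact: ler_pM.
apply: le_trans (lerD m1 m2) _; rewrite le_eqVlt; apply/orP; left; apply/eqP.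
by rewrite -natr1 !exprS; ring.
Qed.

Definition perm_count : R := #|{: 'S_n}|%:R.

Lemma sum_perm_le (F : 'S_n -> R) (b : R) : (forall s, `|F s| <= b) ->
  `|\sum_s F s| <= perm_count * b.
Proof.
move=> Fb; apply: le_trans (ler_norm_sum _ _ _) _.
rewrite /perm_count mulr_natl -sumr_const.
by apply: ler_sum => s _; exact: Fb.
Qed.

Lemma det_lipschitz A A' (B e : R) : 1 <= B -> 0 <= e ->
  (forall i j, `|A i j| <= B) -> (forall i j, `|A' i j| <= B) ->
  (forall i j, `|A i j - A' i j| <= e) ->
  `|\det A - \det A'| <= perm_count * (n%:R * B ^+ n) * e.
Proof.
move=> B1 e0 AB A'B AA'; rewrite /determinant -sumrB -mulrA.
apply: sum_perm_le => s; rewrite -mulrBr normrMsign.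
have := @prod_lipschitz _ (index_enum 'I_n) (fun i => A i (s i))
  (fun i => A' i (s i)) B e B1 e0.
by rewrite /index_enum -enumT size_enum_ord; apply.
Qed.

Lemma det_bound A (B : R) : (forall i j, `|A i j| <= B) ->
  `|\det A| <= perm_count * B ^+ n.
Proof.
move=> AB; apply: sum_perm_le => s; rewrite normrMsign normr_prod.
rewrite -[n in B ^+ n]card_ord -prodr_const; apply: ler_prod => i _.
by rewrite normr_ge0 AB.
Qed.

(** Sylvester's identity for a rank one perturbation, by factoring one block
    matrix in two ways. *)
Lemma det_one_plus_rank1 (u : 'cV[R]_n) v :
  \det (1%:M + u *m v) = 1 + (v *m u) 0 0.
Proof.
pose M := block_mx (1%:M : 'M[R]_1) (- v) u 1%:M.
have E1 : M = block_mx 1%:M 0 u 1%:M *m block_mx 1%:M (- v) 0 (1%:M + u *m v).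
  rewrite mulmx_block !(mul1mx, mulmx1, mulmx0, mul0mx, addr0, add0r) mulmxN.
  by rewrite addrCA addNr addr0.
have E2 : M = block_mx (1%:M + v *m u) (- v) 0 1%:M *m block_mx 1%:M 0 u 1%:M.
  rewrite mulmx_block !(mul1mx, mulmx1, mulmx0, mul0mx, addr0, add0r) mulNmx.
  by rewrite addrK.
have := congr1 determinant E2; rewrite {1}E1 !det_mulmx !det_lblock !det_ublock.
by rewrite !det1 !(mul1r, mulr1) det_mx11 !mxE.
Qed.

Lemma sqnorm2_ge0 v : 0 <= sqnorm2 v.
Proof. by apply: sumr_ge0 => i _; exact: sqr_ge0. Qed.

Lemma mul_row_trmx v : (v *m v^T) 0 0 = sqnorm2 v.
Proof. by rewrite mxE; apply: eq_bigr => i _; rewrite mxE expr2. Qed.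

Lemma mul_coord_le v i j : `|v 0 i * v 0 j| <= sqnorm2 v.
Proof.
have vk k : v 0 k ^+ 2 <= sqnorm2 v.
  rewrite /sqnorm2 (bigD1 k) //= lerDl.
  by apply: sumr_ge0 => l _; exact: sqr_ge0.
have := vk i; have := vk j; have := sqr_ge0 (v 0 i - v 0 j).
have := sqr_ge0 (v 0 i + v 0 j); rewrite ler_norml => *.
by apply/andP; split; nra.
Qed.

(** For a fixed [v] these matrices commute; the Jacobian matrices of the position
    and of the velocity are both of this form, up to a common right factor. *)
Definition rank1_pert (q r : R) v : 'M[R]_n := q%:M + r *: (v^T *m v).

Lemma rank1_pertE q r v i j :
  rank1_pert q r v i j = q *+ (i == j) + r * (v 0 i * v 0 j).
Proof. by rewrite !mxE big_ord1 mxE. Qed.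

Lemma det_rank1_pert q r v : q != 0 ->
  \det (rank1_pert q r v) = q ^+ n * (1 + r / q * sqnorm2 v).
Proof.
move=> q0; have -> : rank1_pert q r v = q *: (1%:M + (r / q *: v^T) *m v).
  rewrite -scalemxAl scalerDr scalerA mulrCA mulfV // mulr1.
  by rewrite scalemx1.
by rewrite detZ det_one_plus_rank1 -scalemxAr mxE mul_row_trmx.
Qed.

Lemma rank1_pert_comm q r q' r' v :
  rank1_pert q r v *m rank1_pert q' r' v =
  rank1_pert (q * q') (q * r' + r * q' + r * r' * sqnorm2 v) v.
Proof.
have E : (v^T *m v) *m (v^T *m v) = sqnorm2 v *: (v^T *m v).
  rewrite mulmxA -(mulmxA v^T v) [v *m v^T]mx11_scalar mul_row_trmx.
  by rewrite mul_mx_scalar -scalemxAl.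
rewrite /rank1_pert; set P := v^T *m v in E *.
rewrite mulmxDl !mulmxDr -scalar_mxM mul_scalar_mx mul_mx_scalar.
rewrite -scalemxAl -scalemxAr E !scalerA -!addrA; congr (_ + _).
by rewrite -!scalerDl; congr (_ *: _); ring.
Qed.

Lemma rank1_pert_bound q r v (b : R) i j : `|q| <= b -> `|r| * sqnorm2 v <= b ->
  `|rank1_pert q r v i j| <= 2 * b.
Proof.
move=> qb rb; rewrite rank1_pertE; apply: le_trans (ler_normD _ _) _.
rewrite mulr_natl mulr2n lerD //.
  by case: (i == j); rewrite ?mulr1n // mulr0n normr0 (le_trans _ qb).
rewrite normrM; apply: le_trans rb.
by apply: ler_wpM2l => //; exact: mul_coord_le.
Qed.

(** Where [\det D] is negative, so is the Jacobian [\det (1 + s W D)] for large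
    [s], uniformly in the positive definite factor [W]: as [W^-1] is bounded,
    this is the sign of [\det (s^-1 W^-1 + D)]. *)
Lemma det_eventually_lt0 (D : 'M[R]_n) : \det D < 0 ->
  exists2 s0 : R, 0 < s0 & forall s r v, s0 <= s -> 0 <= r ->
    \det (1%:M + s *: (rank1_pert 1 r v *m D)) < 0.
Proof.
move=> D0; pose m := \big[Num.max/0]_(ij : 'I_n * 'I_n) `|D ij.1 ij.2|.
have Dm i j : `|D i j| <= m by exact: (le_bigmax _ _ (i, j)).
have m0 : 0 <= m by exact: bigmax_ge_id.
(* [m + 2] bounds the entries of [D + s^-1 W^-1] when [s >= 1], as those of
   [W^-1] are at most 2; [C] is then the Lipschitz constant of [\det] there *)
pose C := perm_count * (n%:R * (m + 2) ^+ n).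
have C0 : 0 <= C by rewrite !mulr_ge0 ?exprn_ge0 ?addr_ge0.
exists (Num.max 1 (2 * C / - \det D + 1)); first by rewrite lt_max ltr01.
move=> s r v; rewrite ge_max => /andP[s1 sC] r0.
have s0 : 0 < s by exact: lt_le_trans s1.
have rv0 : 0 <= r * sqnorm2 v by rewrite mulr_ge0 // sqnorm2_ge0.
have rv1 : 0 < 1 + r * sqnorm2 v by rewrite ltr_wpDr.
(* the inverse of [W] is given by the Sherman-Morrison formula *)
pose W' := rank1_pert 1 (- (r / (1 + r * sqnorm2 v))) v.
have WW' : rank1_pert 1 r v *m W' = 1%:M.
  rewrite rank1_pert_comm mulr1 [X in rank1_pert _ X](_ : _ = 0).
    by rewrite /rank1_pert scale0r addr0.
  by field; rewrite gt_eqF.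
have -> : 1%:M + s *: (rank1_pert 1 r v *m D) =
    (s *: rank1_pert 1 r v) *m (s^-1 *: W' + D).
  rewrite mulmxDr -scalemxAl -scalemxAr WW' scalerA mulfV ?gt_eqF // scale1r.
  by rewrite -scalemxAl.
rewrite det_mulmx detZ det_rank1_pert ?oner_eq0 // expr1n mul1r invr1 mulr1.
rewrite pmulr_rlt0; last by rewrite mulr_gt0 // exprn_gt0.
have W'b i j : `|W' i j| <= 2.
  rewrite -[leRHS]mulr1; apply: rank1_pert_bound; first by rewrite normr1.
  rewrite normrN ger0_norm; last by rewrite divr_ge0 // ltW.
  by rewrite mulrAC ler_pdivrMr // mul1r lerDr.
have sV : s^-1 <= 1 by rewrite invf_le1.
have W's i j : `|s^-1 * W' i j| <= 2 / s.
  rewrite normrM gtr0_norm ?invr_gt0 // mulrC ler_wpM2r // invr_ge0 ltW //.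
have s2 : 2 / s <= 2 by rewrite ler_piMr.
clearbody W'.
have : `|\det (s^-1 *: W' + D) - \det D| <= C * (2 / s).
  apply: det_lipschitz => [||i j|i j|i j].
  - by lra.
  - by rewrite divr_ge0 // ltW.
  - rewrite !mxE; apply: le_trans (ler_normD _ _) _.
    by rewrite (addrC m) lerD // (le_trans (W's i j)).
  - by rewrite (le_trans (Dm i j)) // lerDl.
  - by rewrite !mxE addrK.
move=> /ler_normlP[_]; rewrite lerBlDl => /le_lt_trans; apply.
rewrite -ltrBrDl sub0r mulrA ltr_pdivrMr //.
have D0' : 0 < - \det D by rewrite oppr_gt0.
rewrite -ltr_pdivrMl // mulrC (mulrC C) (lt_le_trans _ sC) //.
by rewrite ltrDl.
Qed.

End Determinants.

Lemma invmx_bound (R : realType) n (A : 'M[R]_n) (B delta : R) i j :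
  0 < delta -> (forall i j, `|A i j| <= B) -> delta <= \det A ->
  `|invmx A i j| <= delta^-1 * (perm_count R n.-1 * B ^+ n.-1).
Proof.
move=> d0 AB dA; have detA : 0 < \det A by exact: lt_le_trans dA.
rewrite /invmx unitmxE unitfE gt_eqF // !mxE normrM.
apply: ler_pM => //; first by rewrite gtr0_norm ?invr_gt0 // lef_pV2.
by rewrite /cofactor normrM normrX normrN1 expr1n mul1r; apply: det_bound => k l;
  rewrite !mxE.
Qed.

(** * Global inversion along a path of maps *)

(** This makes Banach's fixed point theorem applicable to row vectors. *)
HB.instance Definition _ (R : realType) (m n : nat) :=
  Uniform_isComplete.Build 'M[R]_(m, n) (@mx_complete R m n).

Section GlobalInversion.
Variables (R : realType) (n : nat).
Implicit Types (f g : 'rV[R]_n -> 'rV[R]_n) (K mu : R).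

(** Injectivity with a [K]-Lipschitz inverse, without reference to the inverse. *)
Definition expanding K f : Prop := forall x y, `|x - y| <= K * `|f x - f y|.

Definition surjective f : Prop := forall y, exists x, f x = y.

Lemma expandingW K K' f : K <= K' -> expanding K f -> expanding K' f.
Proof. by move=> KK' fK x y; apply: le_trans (fK x y) _; exact: ler_wpM2r. Qed.

Lemma expanding_inj K f : expanding K f -> injective f.
Proof.
move=> fK x y fxy; apply/eqP; rewrite -subr_eq0 -normr_le0.
by have := fK x y; rewrite fxy subrr normr0 mulr0.
Qed.

Lemma perturb_expanding K mu f g : 0 < K -> K * mu <= 2^-1 -> expanding K f ->
  (forall x y, `|(g x - f x) - (g y - f y)| <= mu * `|x - y|) ->
  expanding (2 * K) g.
Proof.
move=> K0 Kmu fK gf x y.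
have E : f x - f y = (g x - g y) - ((g x - f x) - (g y - f y)).
  by apply/rowP => j; rewrite !mxE; ring.
have h1 : `|x - y| <= K * (`|g x - g y| + mu * `|x - y|).
  apply: le_trans (fK x y) _; rewrite ler_pM2l // E.
  by apply: le_trans (ler_normB _ _) _; rewrite lerD2l.
have h2 : K * mu * `|x - y| <= 2^-1 * `|x - y| by exact: ler_wpM2r.
by move: h1 h2; rewrite mulrDr mulrA; lra.
Qed.

(** [g x = y] is the fixed point equation [x = f^-1 (y - (g x - f x))]. *)
Lemma perturb_surjective K mu f g : 0 < K -> 0 <= mu -> K * mu <= 2^-1 ->
  expanding K f -> surjective f ->
  (forall x y, `|(g x - f x) - (g y - f y)| <= mu * `|x - y|) ->
  surjective g.
Proof.
move=> K0 mu0 Kmu fK /choice[Y fY] gf y.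
pose h x := Y (y - (g x - f x)).
have ctr : is_contraction [fun of totalfun h].
  have q0 : (0 : R) <= 2^-1 by rewrite invr_ge0.
  exists (NngNum q0); split => /=; first by rewrite invf_lt1 ?ltr1n.
  move=> [x z] _ /=; apply: le_trans (fK _ _) _; rewrite !fY.
  have -> : y - (g x - f x) - (y - (g z - f z)) = - ((g x - f x) - (g z - f z)).
    by apply/rowP => j; rewrite !mxE; ring.
  rewrite normrN; apply: (@le_trans _ _ (K * (mu * `|x - z|))).
    by rewrite ler_pM2l //; exact: gf.
  by rewrite mulrA ler_wpM2r.
have [||x _ xE] := banach_fixed_point ctr.
- exact: closedT.
- by exists 0.
exists x; have fx : f x = y - (g x - f x) by rewrite {1}xE fY.
by have /eqP := fx; rewrite eq_sym subr_eq addrCA subrr addr0 => /eqP.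
Qed.

(** The Lipschitz constant of an inverse is controlled by the inverse of the
    Jacobian matrix, whatever a priori constant it was obtained with. *)
Lemma expanding_of_jacobian (K K1 : R) g (A : 'rV[R]_n -> 'M[R]_n) :
  expanding K g -> surjective g ->
  (forall x j, first_order (nbhs x) (dspace x) (fun y => g y 0 j) (g x 0 j)
     (A x j)) ->
  (forall x, \det (A x) != 0) ->
  (forall x i j, `|invmx (A x) i j| <= K1) -> expanding (n%:R * K1) g.
Proof.
move=> gK /choice[Y gY] gA A0 AK.
have Yg x : Y (g x) = x by apply: (expanding_inj gK); rewrite gY.
have YK x y : `|Y x - Y y| <= K * `|x - y| by have := gK (Y x) (Y y); rewrite !gY.
have Yc x : Y y @[y --> x] --> Y x.
  apply/(@cvgrPdist_le _ _ _ (nbhs x)) => e e0.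
  have [K0|K0] := ltP 0 K; last first.
    apply: nearW => y; apply: le_trans (YK _ _) _; apply: le_trans (ltW e0).
    by rewrite mulr_le0_ge0.
  have eK : 0 < e / K by rewrite divr_gt0.
  have xe : \forall y \near x, `|x - y| <= e / K.
    exact: (@cvgr_dist_le _ _ _ (nbhs x) _ id x _ _ eK).
  apply: filterS xe => y xy.
  by apply: le_trans (YK _ _) _; rewrite mulrC -ler_pdivlMr.
have Yfo x j : first_order (nbhs x) (dspace x) (fun y => Y y 0 j) (Y x 0 j)
    (fun k => invmx (A (Y x)) j k).
  have /choice[Phi PhiP] i : exists Phi : 'I_n -> 'rV[R]_n -> R,
      (forall k, Phi k p @[p --> Y x] --> A (Y x) i k) /\
      \forall p \near Y x, g p 0 i = g (Y x) 0 i +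
        \sum_k dspace (Y x) k p * Phi k p.
    by have [Phi PA gE] := gA (Y x) i; exists Phi.
  (* [fo_solve] applies to the expansion of [g] at [Y x], substituted in
     [g (Y y) = y] *)
  apply: (fo_eq _ (erefl _) _ (@fo_solve _ _ (nbhs x) _ _ (dspace x) n
    (fun j y => Y y 0 j) (dspace x) (fun j => Y x 0 j)
    (fun y => \matrix_(i, k) Phi i k (Y y)) (A (Y x))
    (fun i k => (k == i)%:R) _ (A0 (Y x)) _ _ j)); first exact: nearW.
  - move=> k; rewrite (bigD1 k) //= eqxx mulr1 big1 ?addr0 // => i ik.
    by rewrite eq_sym (negPf ik) mulr0.
  - move=> i k; under eq_fun do rewrite mxE.
    exact: (cvg_comp _ _ (Yc x) ((PhiP i).1 k)).
  - by move=> i; exact: fo_coord.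
  have gE : \forall p \near Y x, forall i, g p 0 i = g (Y x) 0 i +
      \sum_k dspace (Y x) k p * Phi i k p.
    exact: (@filter_forall _ _ _ (nbhs (Y x)) _ (fun i => (PhiP i).2)).
  have YgE : \forall y \near x, forall i, g (Y y) 0 i = g (Y x) 0 i +
      \sum_k dspace (Y x) k (Y y) * Phi i k (Y y) by exact: Yc x _ gE.
  apply: (@filterS _ (nbhs x) _ _ _ _ YgE) => y gyE i.
  have := gyE i; rewrite !gY /dspace => ->; rewrite addrAC subrr add0r.
  by apply: eq_bigr => k _; rewrite mxE mulrC.
have Yp x j k : has_partial (fun y => Y y 0 j) k x /\
    partial (fun y => Y y 0 j) k x = invmx (A (Y x)) j k.
  exact: partial_of_fo (Yfo x j).
move=> x y; rewrite -{1}(Yg x) -{1}(Yg y); apply: norm_le_coord => [|j].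
  have [j _|n0] := pickP (fun j : 'I_n => true).
    rewrite !mulr_ge0 //.
    by apply: le_trans (AK x j j); exact: normr_ge0.
  suff -> : n%:R = 0 :> R by rewrite !mul0r.
  by move: n0; case: (n) => // m /(_ ord0).
rewrite !mxE; apply: (@partial_lipschitz R n (fun y => Y y 0 j)) => i z.
  exact: (Yp z j i).1.
by rewrite (Yp z j i).2.
Qed.

(** Starting from the identity, the inverse is continued in time by small
    perturbations.  All steps can have the same size, because after each one the
    Lipschitz constant of the inverse is brought back to the bound that the
    Jacobian matrix provides. *)
Lemma path_inversion (X : R -> 'rV[R]_n -> 'rV[R]_n)
    (A : R -> 'rV[R]_n -> 'M[R]_n) (tau C K1 : R) :
  (forall x, X 0 x = x) -> 0 <= C -> 0 <= K1 ->
  (forall t x j, 0 <= t <= tau -> first_order (nbhs x) (dspace x)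
     (fun y => X t y 0 j) (X t x 0 j) (A t x j)) ->
  (forall t x, 0 <= t <= tau -> \det (A t x) != 0) ->
  (forall t x i j, 0 <= t <= tau -> `|invmx (A t x) i j| <= K1) ->
  (forall s t x y, 0 <= s <= tau -> 0 <= t <= tau ->
     `|(X t x - X s x) - (X t y - X s y)| <= C * `|t - s| * `|x - y|) ->
  forall t, 0 <= t <= tau -> surjective (X t) /\ expanding (n%:R * K1 + 1) (X t).
Proof.
move=> X0 C0 K10 XA A0 AK XC; set K := n%:R * K1 + 1.
have K0 : 0 < K by rewrite ltr_wpDl // mulr_ge0.
(* over a time [h] the map [X t] changes by a map with Lipschitz constant
   [C * h], small enough for [perturb_surjective] *)
pose h := (2 * K * (C + 1))^-1.
have C1 : 0 < C + 1 by rewrite ltr_wpDl.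
have h0 : 0 < h by rewrite invr_gt0 !mulr_gt0.
have Kh : K * (C * h) <= 2^-1.
  have -> : K * (C * h) = 2^-1 * (C / (C + 1)).
    by rewrite /h; field; rewrite !gt_eqF.
  by rewrite ler_piMr ?invr_ge0 // ler_pdivrMr // mul1r lerDl.
have base : surjective (X 0) /\ expanding K (X 0).
  split=> [y|x y]; first by exists y.
  by rewrite !X0 ler_peMl // /K lerDr mulr_ge0.
suff steps (k : nat) t : 0 <= t <= tau -> t <= k%:R * h ->
    surjective (X t) /\ expanding K (X t).
  move=> t /andP[t0 ttau]; apply: (steps (Num.truncn (t / h)).+1).
    by rewrite t0.
  by rewrite -ler_pdivrMr // ltW // truncnS_gt.
elim: k t => [t /andP[t0 _]|k IH t /andP[t0 tt] tk].
  by rewrite mul0r => t0'; have -> : t = 0 by apply/eqP; rewrite eq_le t0' t0.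
pose s := Num.max 0 (t - h).
have s0 : 0 <= s by rewrite le_max lexx.
have sk : s <= k%:R * h.
  rewrite ge_max mulr_ge0 ?(ltW h0) //= lerBlDr.
  by move: tk; rewrite -natr1 mulrDl mul1r.
have st : s <= t by rewrite ge_max t0 lerBlDr lerDl ltW.
have tsh : `|t - s| <= h.
  by rewrite ger0_norm ?subr_ge0 // lerBlDr -lerBlDl le_max lexx orbT.
have stau : 0 <= s <= tau by rewrite s0 (le_trans st).
have ttau : 0 <= t <= tau by rewrite t0.
have [sS sE] := IH s stau sk.
have XCh x y : `|(X t x - X s x) - (X t y - X s y)| <= C * h * `|x - y|.
  apply: le_trans (XC s t x y stau ttau) _.
  by rewrite ler_wpM2r // ler_wpM2l.
have tS := perturb_surjective K0 (mulr_ge0 C0 (ltW h0)) Kh sE sS XCh.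
split=> //; apply: (@expandingW (n%:R * K1)); first by rewrite lerDl.
apply: expanding_of_jacobian (perturb_expanding K0 Kh sE XCh) tS _ _ _.
- by move=> x j; exact: XA.
- by move=> x; exact: A0.
by move=> x i j; exact: AK.
Qed.

End GlobalInversion.

(** * The scale factor and the displacement integral *)

(** This is [(1 - w)^(-1/2)].  If [rho] is the square of the ratio of the initial
    speed of a particle to [c], then its velocity at time [t] is the initial one
    multiplied by [lorentz (rho * (1 - a^-2)) / a]. *)
Definition lorentz (R : realType) (w : R) : R := (Num.sqrt (1 - w))^-1.

(** With [x] and [y] the values of [lorentz] at two points, this is its difference
    quotient between these points, in a form that makes sense on the diagonal. *)
Definition lorentz_slope (R : realType) (x y : R) : R :=
  x ^+ 2 * y ^+ 2 / (x + y).

Section Lorentz.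
Variable R : realType.
Implicit Types w : R.
Local Notation P := (@lorentz R).
Local Notation S := (@lorentz_slope R).

Lemma lorentz_bounds w : 0 <= w <= 2^-1 ->
  [/\ 1 <= P w, P w ^+ 2 <= 2 & P w ^+ 2 * (1 - w) = 1].
Proof.
move=> /andP[w0 w1].
have w2 : 2^-1 <= 1 - w by lra.
have w3 : 0 < 1 - w by lra.
have s0 : 0 < Num.sqrt (1 - w) by rewrite sqrtr_gt0.
have sE : Num.sqrt (1 - w) ^+ 2 = 1 - w by rewrite sqr_sqrtr // ltW.
split.
- by rewrite /lorentz invf_ge1 // -[leRHS]sqrtr1 ler_sqrt //; lra.
- rewrite /lorentz exprVn sE -[leRHS]invrK lef_pV2 ?posrE ?invr_gt0 //.
- by rewrite /lorentz exprVn sE mulVf // gt_eqF.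
Qed.

Lemma lorentz_slope_bounds x y : 1 <= x -> x ^+ 2 <= 2 -> 1 <= y -> y ^+ 2 <= 2 ->
  0 <= S x y <= 2.
Proof.
move=> x1 x2 y1 y2; have xy0 : 0 < x + y by lra.
rewrite /lorentz_slope; apply/andP; split.
  by apply: divr_ge0; [rewrite mulr_ge0 ?sqr_ge0|exact: ltW].
have : x ^+ 2 * y ^+ 2 <= 2 * 2 by apply: ler_pM; rewrite ?sqr_ge0.
by rewrite ler_pdivrMr //; lra.
Qed.

(** In terms of the values [p] and [q] of [lorentz] the arguments are [1 - p^-2]
    and [1 - q^-2]. *)
Lemma lorentzB w w' : 0 <= w <= 2^-1 -> 0 <= w' <= 2^-1 ->
  P w' - P w = (w' - w) * S (P w) (P w').
Proof.
move=> /lorentz_bounds[p1 _ pE] /lorentz_bounds[q1 _ qE].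
rewrite /lorentz_slope; set p := P w in p1 pE *; set q := P w' in q1 qE *.
have pq0 : p + q != 0 by rewrite gt_eqF //; lra.
have p0 : p != 0 by rewrite gt_eqF //; lra.
have q0 : q != 0 by rewrite gt_eqF //; lra.
have wE : w = 1 - (p ^+ 2)^-1.
  rewrite (_ : (p ^+ 2)^-1 = 1 - w); first by ring.
  by apply: (mulfI (expf_neq0 2 p0)); rewrite pE mulfV // expf_neq0.
have w'E : w' = 1 - (q ^+ 2)^-1.
  rewrite (_ : (q ^+ 2)^-1 = 1 - w'); first by ring.
  by apply: (mulfI (expf_neq0 2 q0)); rewrite qE mulfV // expf_neq0.
rewrite wE w'E; field; by rewrite ?(p0, q0, pq0).
Qed.

Lemma lorentz_lipschitz w w' : 0 <= w <= 2^-1 -> 0 <= w' <= 2^-1 ->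
  `|P w' - P w| <= 2 * `|w' - w|.
Proof.
move=> wI w'I; rewrite lorentzB // normrM mulrC ler_wpM2r //.
have [p1 p2 _] := lorentz_bounds wI; have [q1 q2 _] := lorentz_bounds w'I.
by have /andP[? ?] := lorentz_slope_bounds p1 p2 q1 q2; rewrite ger0_norm.
Qed.

Lemma lorentz_slopeC x y : S x y = S y x.
Proof. by rewrite /lorentz_slope (mulrC (x ^+ 2)) (addrC x). Qed.

Lemma lorentz_slope_lipschitz x x' y : 1 <= x -> 1 <= x' -> 1 <= y ->
  y ^+ 2 <= 2 -> `|S x y - S x' y| <= 2 * `|x - x'|.
Proof.
move=> x1 x'1 y1 y2.
have d1 : 0 < x + y by lra.
have d2 : 0 < x' + y by lra.
have -> : S x y - S x' y = y ^+ 2 *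
    ((x * x' + y * (x + x')) / ((x + y) * (x' + y))) * (x - x').
  by rewrite /lorentz_slope; field; rewrite !gt_eqF.
rewrite normrM ler_wpM2r // ger0_norm; last first.
  rewrite mulr_ge0 ?sqr_ge0 // divr_ge0 //; last by rewrite ltW // mulr_gt0.
  by rewrite addr_ge0 // mulr_ge0 //; lra.
rewrite -[leRHS]mulr1 ler_pM ?sqr_ge0 //.
  rewrite divr_ge0 //; last by rewrite ltW // mulr_gt0.
  by rewrite addr_ge0 // mulr_ge0 //; lra.
rewrite ler_pdivrMr ?mulr_gt0 // mul1r.
by have := sqr_ge0 y; rewrite mulrDl !mulrDr expr2; lra.
Qed.

Lemma lorentz_slope_lorentz_lipschitz w1 w2 w1' w2' :
  0 <= w1 <= 2^-1 -> 0 <= w2 <= 2^-1 -> 0 <= w1' <= 2^-1 -> 0 <= w2' <= 2^-1 ->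
  `|S (P w1) (P w2) - S (P w1') (P w2')| <= 4 * (`|w1 - w1'| + `|w2 - w2'|).
Proof.
move=> I1 I2 J1 J2.
have [p1 p1s _] := lorentz_bounds I1; have [p2 p2s _] := lorentz_bounds I2.
have [q1 q1s _] := lorentz_bounds J1; have [q2 q2s _] := lorentz_bounds J2.
have A := lorentz_slope_lipschitz p1 q1 p2 p2s.
have B := lorentz_slope_lipschitz p2 q2 q1 q1s.
have C := lorentz_lipschitz J1 I1; have D := lorentz_lipschitz J2 I2.
have -> : S (P w1) (P w2) - S (P w1') (P w2') =
    (S (P w1) (P w2) - S (P w1') (P w2)) + (S (P w2) (P w1') - S (P w2') (P w1')).
  by rewrite (lorentz_slopeC (P w2)) (lorentz_slopeC (P w2')); ring.
by apply: le_trans (ler_normD _ _) _; move: A B C D; lra.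
Qed.

End Lorentz.

Section ScaleFactor.
Variables (R : realType) (a : R -> R).
Hypotheses (aS : scale_factor a) (aH : assumption_H3 a).

Lemma scale_dtime t : 0 <= t -> is_dtime a t (derive_time a t).
Proof. by move=> t0; apply/derivable_timeP; exact: scale_derivable. Qed.

Lemma scale_ge1 t : 0 <= t -> 1 <= a t.
Proof.
move=> t0; rewrite -(scale_init aS).
apply: (@time_ge0_le R a (derive_time a)) => // s /andP[s0 _].
  exact: scale_dtime.
by apply: ltW; exact: H3_velocity.
Qed.

Lemma scale_neq0 t : 0 <= t -> a t != 0.
Proof. by move=> t0; rewrite gt_eqF // scale_gt0. Qed.

Definition iscale (t : R) : R := (a t)^-1.
Definition theta (t : R) : R := 1 - iscale t ^+ 2.

Lemma iscale_bounds t : 0 <= t -> 0 < iscale t <= 1.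
Proof.
move=> t0; rewrite invr_gt0 scale_gt0 //=.
by rewrite invf_le1 ?scale_gt0 // scale_ge1.
Qed.

Lemma iscale2_bounds t : 0 <= t -> 0 < iscale t ^+ 2 <= 1.
Proof.
move=> /iscale_bounds/andP[i0 i1].
by rewrite exprn_gt0 //= expr_le1 // ltW.
Qed.

Lemma theta_bounds t : 0 <= t -> 0 <= theta t <= 1.
Proof. by move=> /iscale2_bounds/andP[? ?]; rewrite /theta; apply/andP; split; lra. Qed.

Lemma iscale_dtime t : 0 <= t ->
  is_dtime iscale t (- (derive_time a t * iscale t ^+ 2)).
Proof.
move=> t0; have aD := scale_dtime t0; have a0 := scale_neq0 t0.
have S : - (iscale s * iscale t) @[s --> nbhs_ge0 t] --> - (iscale t * iscale t).
  apply: cvgN; apply: cvgM; last exact: cvg_cst.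
  by apply: cvgV => //; exact: dtime_cvg aD.
apply: dtime_of_fo; apply: (fo_eq _ (erefl _) _
  (fo_subst1 (g := iscale) (a := iscale t) (foB (fo_of_dtime aD)) S _)).
- exact: nearW.
- by move=> _; ring.
have s0 : \forall s \near nbhs_ge0 t, 0 <= s by exact: withinT.
apply: filterS s0 => s s0; rewrite /iscale; field.
by rewrite a0 scale_neq0.
Qed.

Lemma theta_dtime t : 0 <= t ->
  is_dtime theta t (2 * derive_time a t * iscale t ^+ 3).
Proof.
move=> t0; have iD := iscale_dtime t0.
have := dtimeB (dtime_cst 1 t) (dtimeM iD iD).
rewrite (_ : 0 - _ = 2 * derive_time a t * iscale t ^+ 3) //; last by ring.
Qed.

(** The scale factor is only known at nonnegative times, whereas primitives are
    taken of functions that are continuous on the whole line. *)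
Definition extend (f : R -> R) (t : R) : R := f (Num.max 0 t).

Lemma extendE f t : 0 <= t -> extend f t = f t.
Proof. by move=> t0; rewrite /extend max_r. Qed.

Lemma extend_cont f (df : R -> R) : (forall t, 0 <= t -> is_dtime f t (df t)) ->
  continuous (extend f).
Proof.
move=> fD t; have mt0 : 0 <= Num.max 0 t by rewrite le_max lexx.
apply: (cvg_comp (Num.max 0) f) (dtime_cvg (fD _ mt0)) => A [e /= e0 eA].
exists e => //= s ts; apply: eA => /=; last by rewrite le_max lexx.
apply: le_lt_trans ts; rewrite /Num.max.
by case: ltP => t0; case: ltP => s0; rewrite ler_norml ?subrr ?normr0 //;
  apply/andP; split; have := ler_norm (t - s); have := ler_norm (s - t);
  rewrite ?(distrC s); lra.
Qed.

Lemma iscale_cont : continuous (extend iscale).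
Proof. exact: extend_cont iscale_dtime. Qed.

Lemma theta_cont : continuous (extend theta).
Proof. exact: extend_cont theta_dtime. Qed.

(** The bound keeps the argument of [lorentz] away from its singularity at 1. *)
Definition admissible (rho : R) : Prop := 0 <= rho <= 2^-1.

Lemma admissible_theta rho t : admissible rho -> 0 <= t ->
  0 <= rho * theta t <= 2^-1.
Proof.
move=> /andP[r0 r1] t0; have /andP[h0 h1] := theta_bounds t0.
by rewrite mulr_ge0 //= (le_trans _ r1) // ler_piMr.
Qed.

Lemma lorentz_theta_cont rho : admissible rho ->
  continuous (extend (fun s => lorentz (rho * theta s))).
Proof.
move=> r t; rewrite /extend /lorentz.
have m0 : 0 <= Num.max 0 t by rewrite le_max lexx.
apply: cvgV.
  rewrite gt_eqF // sqrtr_gt0.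
  by have /andP[_] := admissible_theta r m0; lra.
apply: (cvg_comp _ (@Num.sqrt R)); last exact: sqrt_continuous.
apply: cvgB; first exact: cvg_cst.
by apply: cvgMl_tmp; exact: theta_cont.
Qed.

Definition disp_rate (rho s : R) : R := iscale s ^+ 2 * lorentz (rho * theta s).

(** The comoving displacement of a particle per unit of initial velocity. *)
Definition disp (t rho : R) : R := primitive (extend (disp_rate rho)) t.

(** The difference quotient of [disp] in [rho] is itself such an integral, and it
    extends continuously to the diagonal: no differentiation under the integral
    sign is needed. *)
Definition disp_slope_rate (rho sig s : R) : R :=
  iscale s ^+ 2 * (theta s *
    lorentz_slope (lorentz (rho * theta s)) (lorentz (sig * theta s))).

Definition disp_slope (t rho sig : R) : R :=
  primitive (extend (disp_slope_rate rho sig)) t.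

Lemma primitiveP (f : R -> R) : continuous f ->
  primitive f 0 = 0 /\ forall t, 0 <= t -> is_dtime (primitive f) t (f t).
Proof.
rewrite /primitive; case: pselect => // cf _.
by case: (primitive_exists cf).
Qed.

Lemma disp_dtime rho t : admissible rho -> 0 <= t ->
  is_dtime (disp ^~ rho) t (disp_rate rho t).
Proof.
move=> r t0; rewrite -(extendE (disp_rate rho) t0).
apply: (primitiveP _).2 => // s; apply: cvgM; last exact: lorentz_theta_cont.
by apply: cvgM; exact: iscale_cont.
Qed.

Lemma disp0 rho : admissible rho -> disp 0 rho = 0.
Proof.
move=> r; apply: (primitiveP _).1 => // s; apply: cvgM.
  by apply: cvgM; exact: iscale_cont.
exact: lorentz_theta_cont.
Qed.

Lemma disp_slope_cont rho sig : admissible rho -> admissible sig ->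
  continuous (extend (disp_slope_rate rho sig)).
Proof.
move=> r s t; have m0 : 0 <= Num.max 0 t by rewrite le_max lexx.
apply: cvgM; first by apply: cvgM; exact: iscale_cont.
apply: cvgM; first exact: theta_cont.
have L1 := @lorentz_theta_cont _ r t; have L2 := @lorentz_theta_cont _ s t.
apply: cvgM; first by apply: cvgM; apply: cvgM.
apply: cvgV; last exact: cvgD.
have [? _ _] := lorentz_bounds (admissible_theta r m0).
have [? _ _] := lorentz_bounds (admissible_theta s m0).
by rewrite gt_eqF //; lra.
Qed.

Lemma disp_slope_dtime rho sig t : admissible rho -> admissible sig -> 0 <= t ->
  is_dtime (fun s => disp_slope s rho sig) t (disp_slope_rate rho sig t).
Proof.
move=> r s t0; rewrite -(extendE (disp_slope_rate rho sig) t0).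
by apply: (primitiveP _).2 => //; exact: disp_slope_cont.
Qed.

Lemma disp_slope0 rho sig : admissible rho -> admissible sig ->
  disp_slope 0 rho sig = 0.
Proof. by move=> r s; apply: (primitiveP _).1 => //; exact: disp_slope_cont. Qed.

Lemma disp_rate_bounds rho t : admissible rho -> 0 <= t ->
  0 <= disp_rate rho t <= 2.
Proof.
move=> r t0; have [p1 p2 _] := lorentz_bounds (admissible_theta r t0).
have /andP[i0 i1] := iscale2_bounds t0.
have p3 : lorentz (rho * theta t) <= 2.
  by have := sqr_ge0 (lorentz (rho * theta t) - 1); rewrite sqrrB1; nra.
have p0 : 0 <= lorentz (rho * theta t) by lra.
rewrite /disp_rate; apply/andP; split; first by rewrite mulr_ge0 // ltW.
by rewrite -[leRHS]mul1r; apply: ler_pM => //; exact: ltW.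
Qed.

Lemma disp_slope_rate_bounds rho sig t : admissible rho -> admissible sig ->
  0 <= t -> 0 <= disp_slope_rate rho sig t <= 2.
Proof.
move=> r s t0; have [p1 p2 _] := lorentz_bounds (admissible_theta r t0).
have [q1 q2 _] := lorentz_bounds (admissible_theta s t0).
have /andP[i0 i1] := iscale2_bounds t0; have /andP[h0 h1] := theta_bounds t0.
have /andP[s0 s1] := lorentz_slope_bounds p1 p2 q1 q2.
rewrite /disp_slope_rate; apply/andP; split.
  exact: (mulr_ge0 (ltW i0) (mulr_ge0 h0 s0)).
rewrite -[leRHS]mul1r; apply: (ler_pM (ltW i0) (mulr_ge0 h0 s0)) => //.
by rewrite -[leRHS]mul1r; apply: ler_pM.
Qed.

(** Both sides vanish at time 0 and have the same time derivative, by [lorentzB]. *)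
Lemma disp_slopeE t rho sig : admissible rho -> admissible sig -> 0 <= t ->
  disp t sig - disp t rho = (sig - rho) * disp_slope t rho sig.
Proof.
move=> r s t0.
pose f u := disp u sig - disp u rho - (sig - rho) * disp_slope u rho sig.
have fD u : 0 <= u <= t -> is_dtime f u 0.
  move=> /andP[u0 _].
  have := dtimeB (dtimeB (disp_dtime s u0) (disp_dtime r u0))
    (dtimeZ (c := sig - rho) (disp_slope_dtime r s u0)).
  rewrite [X in is_dtime _ _ X](_ : _ = 0) //.
  rewrite /disp_rate /disp_slope_rate -mulrBr lorentzB ?admissible_theta //.
  by ring.
have [c _] := time_mvt (lexx 0) t0 fD.
rewrite mulr0 /f !disp0 // disp_slope0 // mulr0 !subr0 => /eqP.
by rewrite subr_eq0 => /eqP.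
Qed.

Lemma disp_lipschitz s t rho : admissible rho -> 0 <= s -> 0 <= t ->
  `|disp t rho - disp s rho| <= 2 * `|t - s|.
Proof.
move=> r s0 t0; apply: (@time_lipschitz R (disp ^~ rho) (disp_rate rho)) => // u u0.
  exact: disp_dtime.
by have /andP[? ?] := disp_rate_bounds r u0; rewrite ger0_norm.
Qed.

Lemma disp_slope_lipschitz s t rho sig : admissible rho -> admissible sig ->
  0 <= s -> 0 <= t ->
  `|disp_slope t rho sig - disp_slope s rho sig| <= 2 * `|t - s|.
Proof.
move=> r q s0 t0.
apply: (@time_lipschitz R (fun u => disp_slope u rho sig)
  (disp_slope_rate rho sig)) => // u u0; first exact: disp_slope_dtime.
by have /andP[? ?] := disp_slope_rate_bounds r q u0; rewrite ger0_norm.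
Qed.

Lemma disp_slope_ge0 t rho sig : admissible rho -> admissible sig -> 0 <= t ->
  0 <= disp_slope t rho sig.
Proof.
move=> r s t0; rewrite -(disp_slope0 r s).
apply: (@time_ge0_le R (fun u => disp_slope u rho sig)
  (disp_slope_rate rho sig)) => // u /andP[u0 _]; first exact: disp_slope_dtime.
by have /andP[] := disp_slope_rate_bounds r s u0.
Qed.

Lemma disp_slope_lipschitz_rho t rho sig rho' sig' : admissible rho ->
  admissible sig -> admissible rho' -> admissible sig' -> 0 <= t ->
  `|disp_slope t rho sig - disp_slope t rho' sig'| <=
    4 * (`|rho - rho'| + `|sig - sig'|) * t.
Proof.
move=> r s r' s' t0; have rI := admissible_theta r; have sI := admissible_theta s.
have r'I := admissible_theta r'; have s'I := admissible_theta s'.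
have := @time_lipschitz R
  (fun u => disp_slope u rho sig - disp_slope u rho' sig')
  (fun u => disp_slope_rate rho sig u - disp_slope_rate rho' sig' u) 0 t
  (4 * (`|rho - rho'| + `|sig - sig'|)) (lexx 0) t0.
rewrite !disp_slope0 // !subrr !subr0 (ger0_norm t0); apply => u u0.
  by apply: dtimeB; exact: disp_slope_dtime.
rewrite /disp_slope_rate -!mulrBr (normrM (iscale u ^+ 2)) (normrM (theta u)).
have /andP[i0 i1] := iscale2_bounds u0; have /andP[h0 h1] := theta_bounds u0.
rewrite (ger0_norm (ltW i0)) (ger0_norm h0).
apply: le_trans (ler_piMl _ i1) _; first by rewrite mulr_ge0.
apply: le_trans (ler_piMl _ h1) _ => //.
apply: le_trans (lorentz_slope_lorentz_lipschitz (rI u u0) (sI u u0)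
  (r'I u u0) (s'I u u0)) _.
by rewrite ler_wpM2l // lerD // -mulrBl normrM (ger0_norm h0) ler_piMr.
Qed.

(** As [l <= 1/2], the rate [a^-2] is bounded below by a multiple of [1/(1+t)],
    whose integral diverges. *)
Lemma disp_unbounded rho (M : R) : admissible rho ->
  exists2 t, 0 <= t & M <= disp t rho.
Proof.
move=> r; have [l [C [l0 l1 C0 aC]]] := H3_growth aH.
have C20 : 0 < C ^- 2 by rewrite invr_gt0 exprn_gt0.
have lnD t : 0 <= t -> is_dtime (fun s => C ^- 2 * ln (1 + s)) t (C ^- 2 * (1 + t)^-1).
  move=> t0; apply: dtimeZ; have t1 : 0 < 1 + t by rewrite ltr_wpDr.
  apply: dtime_of_derive; have lnD : is_derive (1 + t) 1 (@ln R) (1 + t)^-1.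
    exact: is_derive1_ln.
  have sD : is_derive t (1 : R) (fun s => 1 + s) 1.
    rewrite (_ : (fun s => 1 + s) = shift 1); first exact: is_derive_shift.
    by apply/funext => s; rewrite /= addrC.
  by have := is_derive1_comp (a := (1 + t)^-1) lnD sD; rewrite mulr1.
have le t : 0 <= t -> C ^- 2 * (1 + t)^-1 <= disp_rate rho t.
  move=> t0; have t1 : 1 <= 1 + t by rewrite lerDl.
  have [p1 _ _] := lorentz_bounds (admissible_theta r t0).
  have /andP[i0 i1] := iscale2_bounds t0.
  (* here [l <= 1/2] enters: [a <= C * (1 + t)^(1/2)] *)
  apply: (@le_trans _ _ (iscale t ^+ 2)); last by rewrite /disp_rate ler_peMr // ltW.
  have [_ aC'] := aC t t0.
  have aC2 : a t <= C * Num.sqrt (1 + t).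
    apply: le_trans aC' _; rewrite ler_pM2l // -powR12_sqrt; last by lra.
    by apply: ler_powR => //; rewrite mul1r in l1 *.
  have at0 : 0 < a t ^+ 2 by rewrite exprn_gt0 // scale_gt0.
  have Ct0 : 0 < C ^+ 2 * (1 + t) by rewrite mulr_gt0 ?exprn_gt0 //; lra.
  rewrite /iscale exprVn -invfM lef_pV2 ?posrE //.
  rewrite -[X in _ * X]sqr_sqrtr; last by lra.
  have a0 : 0 <= a t by apply/ltW/scale_gt0.
  have Cs : 0 <= C * Num.sqrt (1 + t) by rewrite mulr_ge0 ?sqrtr_ge0 ?ltW.
  by rewrite -exprMn ler_sqr.
have big t : 0 <= t -> C ^- 2 * ln (1 + t) <= disp t rho.
  move=> t0.
  have := @time_ge0_le R (fun s => disp s rho - C ^- 2 * ln (1 + s))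
    (fun s => disp_rate rho s - C ^- 2 * (1 + s)^-1) 0 t (lexx 0) t0.
  rewrite disp0 // addr0 ln1 mulr0 subrr subr_ge0; apply=> s /andP[s0 _].
    by apply: dtimeB; [exact: disp_dtime|exact: lnD].
  by rewrite subr_ge0 le.
pose t := expR (`|M| * C ^+ 2) - 1.
have t0 : 0 <= t by rewrite subr_ge0 (le_trans _ (expR_ge1Dx _)) // lerDl mulr_ge0 ?sqr_ge0.
exists t => //; apply: le_trans (big t t0).
rewrite /t addrC subrK expRK mulrC mulfK ?ler_norm //.
by rewrite expf_neq0 // gt_eqF.
Qed.

End ScaleFactor.

(** * The characteristic flow *)

Lemma cvg_dist_bound (R : realType) (U : Type) (F : set_system U) {FF : Filter F}
    (f b : U -> R) (l : R) : (\forall u \near F, `|l - f u| <= b u) ->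
  b u @[u --> F] --> (0 : R) -> f u @[u --> F] --> l.
Proof.
move=> fb b0; apply/cvgrPdist_le => e e0.
apply: filterS2 fb (cvgr_le _ b0 _ e0) => u.
exact: le_trans.
Qed.

Lemma fo_fst (R : realType) n (T t L : R) (x : 'rV[R]_n) (f : R -> R) :
  is_dtime f t L ->
  first_order (nbhs_slab T t x) (dslab t x) (fun p => f p.1) (f t)
    (fun k => if k is Some _ then 0 else L).
Proof.
move=> /fo_of_dtime fL.
have gam : fst @ nbhs_slab T t x --> nbhs_ge0 t.
  move=> A wA; have nA : \forall p \near nbhs_slab T t x, 0 <= p.1 -> A p.1.
    exact: (@nbhs_slab_fst _ _ T t x _ wA).
  suff : \forall p \near nbhs_slab T t x, A p.1 by [].
  by apply: filterS2 (nbhs_slab_in T t x) nA => p /andP[p0 _]; apply.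
have dM (j : 'I_1) : first_order (nbhs_slab T t x) (dslab t x)
    (fun p => dtime t j p.1) 0 (fun k => (k == None)%:R) by exact: fo_coord.
apply: (fo_eq _ (erefl _) _ (fo_chain gam dM fL)); first exact: nearW.
by case=> [j|]; rewrite big_ord1 ?mulr0 ?mulr1.
Qed.

Lemma fo_snd (R : realType) n (T t : R) (x : 'rV[R]_n) g (L : 'I_n -> R) :
  first_order (nbhs x) (dspace x) g (g x) L ->
  first_order (nbhs_slab T t x) (dslab t x) (fun p => g p.2) (g x)
    (fun k => if k is Some j then L j else 0).
Proof.
move=> gL; have gam : snd @ nbhs_slab T t x --> x by exact: nbhs_slab_snd.
have dM (j : 'I_n) : first_order (nbhs_slab T t x) (dslab t x)
    (fun p => dspace x j p.2) 0 (fun k => (k == Some j)%:R) by exact: fo_coord.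
apply: (fo_eq _ (erefl _) _ (fo_chain gam dM gL)); first exact: nearW.
case=> [j|] /=; last by rewrite big1 // => i _; rewrite mulr0.
rewrite (bigD1 j) //= eqxx mulr1 big1 ?addr0 // => i ij.
by rewrite (inj_eq Some_inj) eq_sym (negPf ij) mulr0.
Qed.

Lemma rank1_mul_entry (R : realType) n (q r : R) (v : 'rV[R]_n) (D : 'M[R]_n) i j :
  (rank1_pert q r v *m D) i j = q * D i j + r * v 0 i * \sum_k v 0 k * D k j.
Proof.
rewrite /rank1_pert mulmxDl mul_scalar_mx -scalemxAl -mulmxA 2!mxE; congr (_ + _).
by rewrite !mxE big_ord1 !mxE mulrA.
Qed.

Section Flow.
Variables (R : realType) (n : nat) (c : R) (a : R -> R).
Variables (v0 : 'rV[R]_n -> 'rV[R]_n) (eps : R).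
Hypotheses (aS : scale_factor a) (aH : assumption_H3 a) (v0C : C2_bounded v0).

Definition kappa : R := (eps / c) ^+ 2.
Definition rho (x : 'rV[R]_n) : R := kappa * sqnorm2 (v0 x).

Hypothesis rho_adm : forall x, admissible (rho x).

Local Notation P t x := (lorentz (rho x * theta a t)).
Local Notation D0 x := (jacobian_mx v0 x).

(** Comoving position and peculiar velocity at time [t] of the particle that
    starts from [x]: along a characteristic the velocity keeps its direction, and
    its modulus solves an explicitly integrable equation. *)
Definition pos (t : R) (x : 'rV[R]_n) : 'rV[R]_n :=
  x + (eps * disp a t (rho x)) *: v0 x.

Definition vel (t : R) (x : 'rV[R]_n) : 'rV[R]_n :=
  (eps * (iscale a t * P t x)) *: v0 x.

(** Up to the factor [eps], the derivatives of [pos - id] and of [vel] are these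
    matrices times the Jacobian matrix of [v0]: the first terms come from [v0], the
    rank one terms from [rho], whose gradient is proportional to
    [v0 *m jacobian_mx v0]. *)
Definition pos_pert t x : 'M[R]_n :=
  rank1_pert (disp a t (rho x)) (2 * kappa * disp_slope a t (rho x) (rho x)) (v0 x).

Definition vel_pert t x : 'M[R]_n :=
  rank1_pert (iscale a t * P t x)
    (kappa * (iscale a t * theta a t * P t x ^+ 3)) (v0 x).

Definition pos_jac t x : 'M[R]_n := 1%:M + eps *: (pos_pert t x *m D0 x).

Definition vel_jac t x : 'M[R]_n := eps *: (vel_pert t x *m D0 x).

Lemma pos_jacE t x i j : pos_jac t x i j = (i == j)%:R + eps *
  (disp a t (rho x) * D0 x i j + 2 * kappa * disp_slope a t (rho x) (rho x) *
     v0 x 0 i * \sum_k v0 x 0 k * D0 x k j).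
Proof.
rewrite /pos_jac [LHS]mxE [X in X + _]mxE [X in _ + X]mxE.
by rewrite rank1_mul_entry.
Qed.

Lemma vel_jacE t x i j : vel_jac t x i j = eps *
  (iscale a t * P t x * D0 x i j + kappa * (iscale a t * theta a t * P t x ^+ 3) *
     v0 x 0 i * \sum_k v0 x 0 k * D0 x k j).
Proof. by rewrite /vel_jac [LHS]mxE rank1_mul_entry. Qed.

Section Expansions.
Variables (T t : R) (x : 'rV[R]_n).
Hypothesis t0T : 0 <= t < T.

Local Notation F := (nbhs_slab T t x).
Local Notation fo := (first_order F (dslab t x)).
Let t0 : 0 <= t. Proof. by case/andP: t0T. Qed.

Let d0 := @dslab0 R n T t x.

Lemma slab_ge0 : \forall p \near F, 0 <= p.1.
Proof. by apply: filterS (nbhs_slab_in T t x) => p /andP[]. Qed.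

Lemma fo_v0 i : fo (fun p => v0 p.2 0 i) (v0 x 0 i)
  (fun k => if k is Some j then D0 x i j else 0).
Proof.
have vC : forall j, partial (fun y => v0 y 0 i) j y @[y --> x]
    --> partial (fun y => v0 y 0 i) j x by move=> j; exact: C2_cont1.
have := fo_snd T t (fo_of_partial (fun j z => @C2_partial _ _ _ v0C i j z) vC).
by apply: fo_eq => //; [exact: nearW|case=> [j|] //; rewrite mxE].
Qed.

Definition rho_grad j : R := 2 * kappa * \sum_k v0 x 0 k * D0 x k j.

Lemma fo_rho : fo (fun p => rho p.2) (rho x)
  (fun k => if k is Some j then rho_grad j else 0).
Proof.
apply: fo_eq (foZ kappa (fo_sum (fun i => foM d0 (fo_v0 i) (fo_v0 i)))) => //.
  by apply: nearW => p; congr (_ * _); apply: eq_bigr => i _; rewrite expr2.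
case=> [j|] /=; last by rewrite big1 ?mulr0 // => i _; rewrite mulr0 addr0.
rewrite /rho_grad -mulrA mulrCA; congr (_ * _).
by rewrite mulr_sumr; apply: eq_bigr => i _; ring.
Qed.

Lemma rho_cvg : rho p.2 @[p --> F] --> rho x.
Proof. exact: (fo_cvg d0 fo_rho). Qed.

Lemma disp_slope_cvg (q r : R * 'rV[R]_n -> R) :
  (forall p, admissible (q p)) -> (forall p, admissible (r p)) ->
  q p @[p --> F] --> rho x -> r p @[p --> F] --> rho x ->
  disp_slope a p.1 (q p) (r p) @[p --> F] --> disp_slope a t (rho x) (rho x).
Proof.
move=> qA rA qx rx.
apply: (@cvg_dist_bound _ _ _ _ _ (fun p =>
  4 * (`|rho x - q p| + `|rho x - r p|) * t + 2 * `|t - p.1|)).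
  apply: filterS slab_ge0 => p p0.
  have -> : disp_slope a t (rho x) (rho x) - disp_slope a p.1 (q p) (r p) =
      (disp_slope a t (rho x) (rho x) - disp_slope a t (q p) (r p)) +
      (disp_slope a t (q p) (r p) - disp_slope a p.1 (q p) (r p)) by ring.
  apply: le_trans (ler_normD _ _) (lerD _ _).
    exact: disp_slope_lipschitz_rho.
  exact: disp_slope_lipschitz.
have c0 (f : R * 'rV[R]_n -> R) (l : R) : f p @[p --> F] --> l ->
    `|l - f p| @[p --> F] --> (0 : R).
  by move=> fl; rewrite -(normr0 R) -(subrr l); apply: cvg_norm; apply: cvgB => //;
    exact: cvg_cst.
have lim0 := cvgD (cvgMr_tmp (b := t) (cvgMl_tmp (a := 4) (cvgD (c0 _ _ qx) (c0 _ _ rx))))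
  (cvgMl_tmp (a := 2) (c0 _ _ (@nbhs_slab_fst R n T t x))).
rewrite addr0 mulr0 mul0r add0r mulr0 in lim0; exact: lim0.
Qed.

(** [disp p.1 (rho p.2)] is [disp p.1 (rho x)], a function of time only, plus
    [rho p.2 - rho x] times the continuous function [disp_slope]. *)
Lemma fo_disp : fo (fun p => disp a p.1 (rho p.2)) (disp a t (rho x))
  (fun k => if k is Some j then disp_slope a t (rho x) (rho x) * rho_grad j
            else disp_rate a (rho x) t).
Proof.
have S : disp_slope a p.1 (rho x) (rho p.2) @[p --> F] -->
    disp_slope a t (rho x) (rho x).
  by apply: disp_slope_cvg => //; [exact: cvg_cst|exact: rho_cvg].
have A : fo (fun p => (rho p.2 - rho x) * disp_slope a p.1 (rho x) (rho p.2)) 0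
    (fun k => disp_slope a t (rho x) (rho x) *
      if k is Some j then rho_grad j else 0).
  by apply: (fo_subst1 (foB fo_rho) S); apply: nearW => p; rewrite add0r.
have B := fo_fst T x (disp_dtime aS aH (rho_adm x) t0).
apply: fo_eq (foD B A).
- apply: filterS slab_ge0 => p p0.
  by rewrite -(disp_slopeE aS aH) // addrCA subrr addr0.
- by rewrite addr0.
by case=> [j|]; rewrite ?add0r ?mulr0 ?addr0.
Qed.

Lemma fo_pos i : fo (fun p => pos p.1 p.2 0 i) (pos t x 0 i)
  (fun k => if k is Some j then pos_jac t x i j else vel t x 0 i * iscale a t).
Proof.
have xi : fo (fun p => p.2 0 i) (x 0 i) (fun k => (k == Some i)%:R).
  apply: fo_eq (foD (fo_cst (F := F) (dslab t x) (x 0 i))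
    (fo_coord (dslab t x) (Some i))).
  - by apply: nearW => p; rewrite /= addrCA subrr addr0.
  - by rewrite addr0.
  by move=> k; rewrite add0r.
apply: fo_eq (foD xi (foM d0 (foZ eps fo_disp) (fo_v0 i))).
- by apply: nearW => p; rewrite !mxE.
- by rewrite !mxE.
case=> [j|] /=.
  by rewrite (inj_eq Some_inj) pos_jacE (eq_sym j) /rho_grad; ring.
by rewrite /vel mxE /disp_rate; ring.
Qed.

Lemma theta_fo : fo (fun p => theta a p.1) (theta a t)
  (fun k => if k is Some _ then 0 else 2 * derive_time a t * iscale a t ^+ 3).
Proof. exact: (fo_fst T x (theta_dtime aS t0)). Qed.

Lemma fo_lorentz : fo (fun p => P p.1 p.2) (P t x)
  (fun k => P t x ^+ 3 / 2 * if k is Some j then theta a t * rho_grad j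
            else rho x * (2 * derive_time a t * iscale a t ^+ 3)).
Proof.
have wfo : fo (fun p => rho p.2 * theta a p.1) (rho x * theta a t)
    (fun k => theta a t * (if k is Some j then rho_grad j else 0) + rho x *
      (if k is Some _ then 0 else 2 * derive_time a t * iscale a t ^+ 3)).
  exact: (foM d0 fo_rho theta_fo).
have wI : 0 <= rho x * theta a t <= 2^-1 by exact: admissible_theta.
have wpI : \forall p \near F, 0 <= rho p.2 * theta a p.1 <= 2^-1.
  by apply: filterS slab_ge0 => p p0; exact: admissible_theta.
have [P1 _ _] := lorentz_bounds wI.
have Pc : P p.1 p.2 @[p --> F] --> P t x.
  apply: (@cvg_dist_bound _ _ _ _ _ (fun p =>
    2 * `|rho x * theta a t - rho p.2 * theta a p.1|)).
    by apply: filterS wpI => p pI; exact: lorentz_lipschitz.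
  rewrite -[X in _ --> X](mulr0 2) -(normr0 R) -(subrr (rho x * theta a t)).
  apply: cvgMl_tmp; apply: cvg_norm; apply: cvgB; first exact: cvg_cst.
  exact: (fo_cvg d0 wfo).
have S : lorentz_slope (P t x) (P p.1 p.2) @[p --> F] --> P t x ^+ 3 / 2.
  have -> : P t x ^+ 3 / 2 = lorentz_slope (P t x) (P t x).
    by rewrite /lorentz_slope; field; rewrite -mulr2n mulrn_eq0 /= gt_eqF //; lra.
  apply: cvgM; first by apply: cvgMl_tmp; apply: cvgM.
  apply: cvgV; first by rewrite gt_eqF //; lra.
  by apply: cvgD => //; exact: cvg_cst.
apply: (fo_eq _ (erefl _) _ (fo_subst1 (g := fun p => P p.1 p.2) (a := P t x)
  (foB wfo) S _)); first exact: nearW.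
- by case=> [j|] /=; rewrite ?mulr0 ?addr0 ?add0r.
apply: filterS wpI => p pI.
by rewrite -lorentzB // addrCA subrr addr0.
Qed.

(** Relates the cubic term of the equation to the derivative of [lorentz]. *)
Lemma sqnorm2_vel : sqnorm2 (vel t x) / c ^+ 2 =
  rho x * (iscale a t * P t x) ^+ 2.
Proof.
rewrite /sqnorm2 (_ : \sum_i _ = (eps * (iscale a t * P t x)) ^+ 2 * sqnorm2 (v0 x)).
  by set p := iscale a t * _; rewrite /rho /kappa expr_div_n exprMn; ring.
by rewrite mulr_sumr; apply: eq_bigr => i _; rewrite mxE exprMn.
Qed.

Lemma fo_vel i : fo (fun p => vel p.1 p.2 0 i) (vel t x 0 i)
  (fun k => if k is Some j then vel_jac t x i j
            else derive_time a t / a t *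
              (sqnorm2 (vel t x) / c ^+ 2 - 1) * vel t x 0 i).
Proof.
have ia := fo_fst T x (iscale_dtime aS t0).
apply: fo_eq (foM d0 (foZ eps (foM d0 ia fo_lorentz)) (fo_v0 i)).
- by apply: nearW => p; rewrite !mxE.
- by rewrite !mxE.
case=> [j|] /=.
  rewrite vel_jacE /rho_grad. by field.
by rewrite sqnorm2_vel /vel mxE -/(iscale a t); field.
Qed.

End Expansions.
End Flow.

(** * The Jacobian determinant of the flow and the critical time *)

Section FlowJacobian.
Variables (R : realType) (n : nat) (c : R) (a : R -> R).
Variables (v0 : 'rV[R]_n -> 'rV[R]_n) (eps M : R).
Hypotheses (aS : scale_factor a) (aH : assumption_H3 a) (v0C : C2_bounded v0).
Hypothesis eps0 : 0 < eps.
Local Notation rho := (rho c v0 eps).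
Local Notation kappa := (kappa c eps).
Hypothesis rho_adm : forall x, admissible (rho x).
Hypothesis v0M : forall x i j, `|jacobian_mx v0 x i j| <= M.
Hypothesis M0 : 0 <= M.

Local Notation P t x := (lorentz (rho x * theta a t)).
Local Notation D0 x := (jacobian_mx v0 x).
Local Notation pos := (pos c a v0 eps).
Local Notation vel := (vel c a v0 eps).
Local Notation pos_jac := (pos_jac c a v0 eps).
Local Notation vel_jac := (vel_jac c a v0 eps).

Lemma kappa_ge0 : 0 <= kappa. Proof. exact: sqr_ge0. Qed.

Section Continuity.
Variables (T t : R) (x : 'rV[R]_n).
Hypothesis t0T : 0 <= t < T.
Local Notation F := (nbhs_slab T t x).
Let t0 : 0 <= t. Proof. by case/andP: t0T. Qed.
Let d0 := @dslab0 R n T t x.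

Lemma jacobian_v0_cvg i j : D0 p.2 i j @[p --> F] --> D0 x i j.
Proof.
under eq_fun do rewrite mxE; rewrite mxE.
apply: (cvg_comp snd (partial (fun y => v0 y 0 i) j) (@nbhs_slab_snd R n T t x)).
exact: C2_cont1.
Qed.

Lemma v0_cvg i : v0 p.2 0 i @[p --> F] --> v0 x 0 i.
Proof. exact: (fo_cvg d0 (fo_v0 v0C T t x i)). Qed.

Lemma mean_jacobian_cvg i j :
  v0 p.2 0 i * \sum_k v0 p.2 0 k * D0 p.2 k j @[p --> F] -->
  v0 x 0 i * \sum_k v0 x 0 k * D0 x k j.
Proof.
apply: cvgM; first exact: v0_cvg.
by apply: cvg_bigsum => k _; apply: cvgM; [exact: v0_cvg|exact: jacobian_v0_cvg].
Qed.

Lemma pos_jac_cvg i j : pos_jac p.1 p.2 i j @[p --> F] --> pos_jac t x i j.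
Proof.
under eq_fun do rewrite pos_jacE; rewrite pos_jacE.
apply: cvgD; first exact: cvg_cst.
apply: cvgMl_tmp; apply: cvgD.
  apply: cvgM; last exact: jacobian_v0_cvg.
  exact: (fo_cvg d0 (fo_disp aS aH v0C rho_adm x t0T)).
under eq_fun do rewrite -mulrA; rewrite -mulrA.
apply: cvgM; last exact: mean_jacobian_cvg.
apply: cvgMl_tmp; apply: disp_slope_cvg => //; exact: rho_cvg.
Qed.

Lemma iscale_cvg : iscale a p.1 @[p --> F] --> iscale a t.
Proof. exact: (fo_cvg d0 (fo_fst T x (iscale_dtime aS t0))). Qed.

Lemma vel_cvg i : vel p.1 p.2 0 i @[p --> F] --> vel t x 0 i.
Proof. exact: (fo_cvg d0 (fo_vel aS aH v0C rho_adm x t0T i)). Qed.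

Lemma vel_jac_cvg i j : vel_jac p.1 p.2 i j @[p --> F] --> vel_jac t x i j.
Proof.
have Pc : P p.1 p.2 @[p --> F] --> P t x.
  exact: (fo_cvg d0 (fo_lorentz aS aH v0C rho_adm x t0T)).
have thc : theta a p.1 @[p --> F] --> theta a t.
  exact: (fo_cvg d0 (theta_fo aS x t0T)).
under eq_fun do rewrite vel_jacE; rewrite vel_jacE.
apply: cvgMl_tmp; apply: cvgD.
  apply: cvgM; last exact: jacobian_v0_cvg.
  by apply: cvgM => //; exact: iscale_cvg.
under eq_fun do rewrite -mulrA; rewrite -mulrA.
apply: cvgM; last exact: mean_jacobian_cvg.
apply: cvgMl_tmp; apply: cvgM.
  by apply: cvgM => //; exact: iscale_cvg.
by do 2 (apply: cvgM => //).
Qed.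

Lemma hubble_cvg : derive_time a p.1 / a p.1 @[p --> F] --> derive_time a t / a t.
Proof.
apply: cvgM; last exact: iscale_cvg.
exact: (fo_cvg d0 (fo_fst T x (derivable_timeP (scale_derivable2 aS t0)))).
Qed.

End Continuity.

(** A Lipschitz constant in time for the entries of [pos_jac], uniform in space:
    the entries of the Jacobian matrix of [v0] are at most [M], [disp] and
    [disp_slope] are 2-Lipschitz and [rho <= 1/2]. *)
Definition jac_rate : R := eps * (M * (2 + 2 * n%:R)).

Lemma jac_rate_ge0 : 0 <= jac_rate.
Proof.
by rewrite mulr_ge0 ?(ltW eps0) // mulr_ge0 // addr_ge0 // mulr_ge0.
Qed.

Lemma pos_jac_lipschitz s t x i j : 0 <= s -> 0 <= t ->
  `|pos_jac t x i j - pos_jac s x i j| <= jac_rate * `|t - s|.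
Proof.
move=> s0 t0; have r := rho_adm x.
have dd := disp_lipschitz aS aH r s0 t0.
have ds := disp_slope_lipschitz aS aH r r s0 t0.
set m := v0 x 0 i * \sum_k v0 x 0 k * D0 x k j.
have km : kappa * `|m| <= n%:R * M * 2^-1.
  have kS : `|kappa * m| <= \sum_(k < n) M * 2^-1.
    rewrite /m mulr_sumr mulr_sumr; apply: le_trans (ler_norm_sum _ _ _) _.
    apply: ler_sum => k _; rewrite mulrA mulrA normrM mulrC ler_pM //.
    rewrite -mulrA normrM ger0_norm ?kappa_ge0 //; case/andP: (r) => _.
    by apply: le_trans; rewrite ler_wpM2l ?kappa_ge0 // mul_coord_le.
  move: kS; rewrite normrM ger0_norm ?kappa_ge0 // sumr_const card_ord.
  by rewrite -mulrnAl -mulr_natl.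
have -> : pos_jac t x i j - pos_jac s x i j = eps *
    ((disp a t (rho x) - disp a s (rho x)) * D0 x i j +
     2 * (disp_slope a t (rho x) (rho x) - disp_slope a s (rho x) (rho x)) *
       (kappa * m)) by rewrite !pos_jacE /m; ring.
rewrite normrM (gtr0_norm eps0) /jac_rate -[X in _ <= X]mulrA ler_pM2l //.
apply: le_trans (ler_normD _ _) _; rewrite [X in X + _]normrM.
rewrite [X in _ + X]normrM [X in _ + X * _]normrM [X in _ + _ * X]normrM.
rewrite (ger0_norm kappa_ge0) (ger0_norm (ler0n R 2)).
have h1 : `|disp a t (rho x) - disp a s (rho x)| * `|D0 x i j| <=
    2 * `|t - s| * M by exact: ler_pM.
have h2 : 2 * `|disp_slope a t (rho x) (rho x) - disp_slope a s (rho x) (rho x)| *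
    (kappa * `|m|) <= 2 * (2 * `|t - s|) * (n%:R * M * 2^-1).
  apply: ler_pM; [exact: mulr_ge0| |by rewrite ler_pM2l|exact: km].
  by rewrite mulr_ge0 // kappa_ge0.
by apply: le_trans (lerD h1 h2) _; lra.
Qed.

Lemma pos0 x : pos 0 x = x.
Proof. by rewrite -[LHS]/(x + (eps * disp a 0 (rho x)) *: v0 x) disp0 // mulr0 scale0r addr0. Qed.

Lemma vel0 x : vel 0 x = eps *: v0 x.
Proof.
rewrite -[LHS]/((eps * (iscale a 0 * lorentz (rho x * theta a 0))) *: v0 x).
rewrite /theta /iscale (scale_init aS) invr1 expr1n subrr mulr0.
by rewrite /lorentz subr0 sqrtr1 invr1 !mulr1.
Qed.

Lemma pos_jac0 x : pos_jac 0 x = 1%:M.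
Proof.
apply/matrixP => i j; rewrite pos_jacE disp0 // disp_slope0 //.
by rewrite mulr0 !mul0r addr0 mulr0 addr0 mxE.
Qed.

Lemma pos_jac_bound t x i j : 0 <= t -> `|pos_jac t x i j| <= 1 + jac_rate * t.
Proof.
move=> t0; have := @pos_jac_lipschitz 0 t x i j (lexx 0) t0.
rewrite pos_jac0 subr0 (ger0_norm t0) => h.
rewrite -[pos_jac t x i j](subrK (1%:M i j)) addrC.
apply: le_trans (ler_normD _ _) (lerD _ h).
by rewrite mxE; case: (i == j); rewrite ?normr1 ?normr0.
Qed.

Lemma pos_space t x i : 0 <= t -> first_order (nbhs x) (dspace x)
  (fun y => pos t y 0 i) (pos t x 0 i) (pos_jac t x i).
Proof.
move=> t0; have t1 : 0 <= t < t + 1 by rewrite t0 ltrDl ltr01.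
have := fo_slab_space (g := fun s y => pos s y 0 i) t1
  (fo_pos aS aH v0C rho_adm x t1 i).
by apply: fo_eq => //; exact: nearW.
Qed.

Lemma pos_lipschitz s t x y : 0 <= s -> 0 <= t ->
  `|(pos t x - pos s x) - (pos t y - pos s y)| <=
  n%:R * jac_rate * `|t - s| * `|x - y|.
Proof.
move=> s0 t0; apply: norm_le_coord => [|i].
  by do 3 (apply: mulr_ge0 => //); exact: jac_rate_ge0.
pose g z := pos t z 0 i - pos s z 0 i.
have gP j z : has_partial g j z /\
    partial g j z = pos_jac t z i j - pos_jac s z i j.
  apply: (partial_of_fo (L := fun j => pos_jac t z i j - pos_jac s z i j)).
  apply: fo_eq (foD (pos_space z i t0) (foZ (-1) (pos_space z i s0))).
  - by apply: nearW => w; rewrite mulN1r.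
  - by rewrite mulN1r.
  by move=> k; rewrite mulN1r.
have := @partial_lipschitz R n g (jac_rate * `|t - s|) y x
  (fun j z => (gP j z).1).
rewrite /g !mxE mulrA; apply=> j z; rewrite (gP j z).2.
exact: pos_jac_lipschitz.
Qed.

Definition jac_det t x : R := \det (pos_jac t x).

Lemma jac_det0 x : jac_det 0 x = 1.
Proof. by rewrite /jac_det pos_jac0 det1. Qed.

Lemma jac_det_lipschitz (B : R) : exists L : R, forall s t x,
  0 <= s <= B -> 0 <= t <= B -> `|jac_det t x - jac_det s x| <= L * `|t - s|.
Proof.
have [B0|B0] := leP 0 B; last first.
  exists 0 => s t x /andP[s0 sB]; suff: 0 < 0 :> R by rewrite ltxx.
  exact: le_lt_trans s0 (le_lt_trans sB B0).
pose b := 1 + jac_rate * B.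
exists (perm_count R n * (n%:R * b ^+ n) * jac_rate) => s t x.
move=> /andP[s0 sB] /andP[t0 tB]; rewrite -mulrA.
have jb u i j : 0 <= u <= B -> `|pos_jac u x i j| <= b.
  move=> /andP[u0 uB]; apply: le_trans (pos_jac_bound x i j u0) _.
  by rewrite lerD2l ler_wpM2l // jac_rate_ge0.
apply: det_lipschitz.
- by rewrite lerDl mulr_ge0 ?jac_rate_ge0.
- by rewrite mulr_ge0 ?jac_rate_ge0.
- by move=> i j; rewrite jb // t0.
- by move=> i j; rewrite jb // s0.
by move=> i j; exact: pos_jac_lipschitz.
Qed.

(** [pos_jac] is [1 + s W D] with [s = eps * disp], which is unbounded. *)
Lemma jac_det_lt0 x : \det (D0 x) < 0 -> exists2 t, 0 <= t & jac_det t x < 0.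
Proof.
move=> D0x; have [s0 s00 neg] := det_eventually_lt0 D0x.
have [t t0 td] := disp_unbounded aS aH (s0 / eps) (rho_adm x).
exists t => //; have d0 : 0 < disp a t (rho x).
  by apply: lt_le_trans td; rewrite divr_gt0.
pose r := 2 * kappa * disp_slope a t (rho x) (rho x) / disp a t (rho x).
have := neg (eps * disp a t (rho x)) r (v0 x).
rewrite mulrC -ler_pdivrMr // => /(_ td).
suff -> : disp a t (rho x) * eps *: (rank1_pert 1 r (v0 x) *m D0 x) =
    eps *: (pos_pert c a v0 eps t x *m D0 x).
  apply; apply: divr_ge0; last exact: ltW.
  apply: mulr_ge0; last exact: disp_slope_ge0.
  by apply: mulr_ge0 => //; exact: kappa_ge0.
rewrite mulrC -scalerA scalemxAl; congr (_ *: (_ *m _)).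
apply/matrixP => i j; rewrite mxE !rank1_pertE /r mulrDr mulrnAr mulr1.
congr (_ + _).
by field; rewrite gt_eqF.
Qed.

End FlowJacobian.

(** Just before the critical time the infimum of [J] is arbitrarily small, even
    though it need not be attained: if [J >= eta] held everywhere at a time close
    enough to [T], the uniform Lipschitz bound would push positivity beyond [T].
    *)
Lemma critical_time (R : realType) (U : Type) (J : R -> U -> R) :
  (forall x, J 0 x = 1) ->
  (forall B, exists L, forall s t x, 0 <= s <= B -> 0 <= t <= B ->
     `|J t x - J s x| <= L * `|t - s|) ->
  (exists t x, 0 <= t /\ J t x < 0) ->
  exists T, [/\ 0 < T,
    forall tau, 0 <= tau < T -> exists2 delta, 0 < delta &
      forall t x, 0 <= t <= tau -> delta <= J t x &
    forall eta, 0 < eta -> \forall t \near T^'-, exists x, J t x < eta].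
Proof.
move=> J0 JL [t1 [x1 [t10 Jneg]]].
pose S := [set tau : R | 0 <= tau /\ exists2 delta, 0 < delta &
  forall t x, 0 <= t <= tau -> delta <= J t x].
have S0 : S 0.
  split=> //; exists 1 => // t x t00.
  have -> : t = 0 by apply/eqP; rewrite eq_le andbC.
  by rewrite J0.
have Sub : ubound S t1.
  move=> tau [tau0 [delta delta0 Jd]]; rewrite leNgt; apply/negP => t1tau.
  have := Jd t1 x1; rewrite t10 (ltW t1tau) => /(_ isT) /(lt_le_trans delta0).
  by rewrite ltNge (ltW Jneg).
have Ssup : has_sup S by split; [exists 0|exists t1].
have JL' B : exists2 L, 0 < L & forall s t x, 0 <= s <= B -> 0 <= t <= B ->
     J s x - L * `|t - s| <= J t x.
  have [L LP] := JL B; exists (`|L| + 1) => [|s t x sB tB].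
    by rewrite ltr_wpDl.
  rewrite lerBlDl -lerBlDr (distrC t).
  apply: le_trans (ler_norm _) _; apply: le_trans (LP t s x tB sB) _.
  by rewrite ler_wpM2r // (le_trans (ler_norm L)) // lerDl.
have below tau : 0 <= tau < sup S -> exists2 delta, 0 < delta &
      forall t x, 0 <= t <= tau -> delta <= J t x.
  move=> /andP[tau0 /(sup_gt (ex_intro _ _ S0))[tau' [_ [delta d0 dJ]]] tt'].
  exists delta => // t x /andP[t0 tt]; apply: dJ.
  by rewrite t0 (le_trans tt) // ltW.
(* a uniform lower bound on the time needed to go from 1 to 1/2 *)
have Tpos : 0 < sup S.
  have [L L0 LP] := JL' 1; pose d := (2 * (L + 1))^-1.
  have L1 : 0 < L + 1 by rewrite addr_gt0.
  have d0 : 0 < d by rewrite invr_gt0 mulr_gt0.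
  have Ld : L * d <= 2^-1.
    by rewrite /d invfM mulrCA ler_piMr ?invr_ge0 // ler_pdivrMr // mul1r; lra.
  have d1 : d <= 1 by rewrite invf_le1 ?mulr_gt0 //; lra.
  apply: (lt_le_trans d0); apply: (ub_le_sup Ssup.2); split; first exact: ltW.
  exists 2^-1 => [|t x /andP[t0 td]]; first by rewrite invr_gt0.
  apply: le_trans (LP 0 t x _ _); rewrite ?lexx ?ler01 // ?t0 ?(le_trans td) //.
  rewrite J0 subr0 ger0_norm //.
  have : L * t <= L * d by rewrite ler_pM2l.
  by lra.
exists (sup S); split=> // eta eta0; set T := sup S in Tpos *.
have T0 : 0 <= T by apply: (ub_le_sup Ssup.2).
have [L L0 LP] := JL' (T + 1); pose d := Num.min 1 (eta / (2 * L)).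
have d0 : 0 < d by rewrite lt_min ltr01 divr_gt0 ?mulr_gt0.
have Ld : L * d <= eta / 2.
  apply: (@le_trans _ _ (L * (eta / (2 * L)))).
    by rewrite ler_pM2l // ge_min lexx orbT.
  by rewrite le_eqVlt; apply/orP; left; apply/eqP; field; rewrite gt_eqF.
have d1 : d <= 1 by rewrite ge_min lexx.
(* a bound [eta] at time [t] persists as [eta / 2] up to time [t + d] *)
have key t : 0 <= t -> t < T -> T < t + d -> exists x, J t x < eta.
  move=> t0 tT Ttd; apply: contrapT => /forallNP noJ.
  have [|delta delta0 dJ] := below t; first by rewrite t0.
  suff /(ub_le_sup Ssup.2) : S (t + d) by rewrite leNgt Ttd.
  split; first by rewrite addr_ge0 // ltW.
  exists (Num.min delta (eta / 2)); first by rewrite lt_min delta0 divr_gt0.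
  move=> s x /andP[s0 std]; rewrite ge_min.
  have [st|ts] := leP s t; first by rewrite dJ // s0.
  apply/orP; right.
  have Jt : eta <= J t x by rewrite leNgt; apply/negP/noJ.
  have := LP t s x; rewrite t0 s0 (ltW (lt_le_trans tT _)) ?lerDl //.
  rewrite (le_trans std) ?lerD ?(ltW tT) // => /(_ isT isT).
  have : L * `|s - t| <= eta / 2.
    apply: le_trans Ld; rewrite ler_pM2l // ger0_norm ?subr_ge0 ?(ltW ts) //.
    by rewrite lerBlDl.
  by lra.
near=> t; apply: key.
- near: t; exact: nbhs_left_ge.
- by near: t; exact: nbhs_left_lt.
- rewrite -ltrBlDr; near: t; apply: nbhs_left_gt; by rewrite ltrBlDr ltrDl.
Unshelve. all: by end_near. Qed.

(** * Existence of the solution up to the critical time *)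

Section Existence.
Variables (R : realType) (n : nat) (c : R) (a : R -> R).
Variables (v0 : 'rV[R]_n -> 'rV[R]_n) (eps M T : R).
Hypotheses (aS : scale_factor a) (aH : assumption_H3 a) (v0C : C2_bounded v0).
Hypothesis eps0 : 0 < eps.
Local Notation rho := (rho c v0 eps).
Local Notation kappa := (kappa c eps).
Hypothesis rho_adm : forall x, admissible (rho x).
Hypothesis v0M : forall x i j, `|jacobian_mx v0 x i j| <= M.
Hypothesis M0 : 0 <= M.
Local Notation pos := (pos c a v0 eps).
Local Notation vel := (vel c a v0 eps).
Local Notation pos_jac := (pos_jac c a v0 eps).
Local Notation vel_jac := (vel_jac c a v0 eps).
Local Notation jac_det := (jac_det c a v0 eps).
Hypothesis T0 : 0 < T.
Hypothesis Jpos : forall tau, 0 <= tau < T -> exists2 delta, 0 < delta &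
  forall t x, 0 <= t <= tau -> delta <= jac_det t x.

Lemma pos_inversion tau : 0 <= tau < T -> exists K : R,
  forall t, 0 <= t <= tau -> surjective (pos t) /\ expanding K (pos t).
Proof.
move=> tauT; have [delta delta0 Jd] := Jpos tauT.
have tau0 : 0 <= tau by case/andP: tauT.
pose B := 1 + jac_rate n eps M * tau.
have jr0 : 0 <= jac_rate n eps M by exact: jac_rate_ge0.
have B0 : 0 <= B by rewrite addr_ge0 // mulr_ge0.
pose K1 := delta^-1 * (perm_count R n.-1 * B ^+ n.-1).
have K10 : 0 <= K1.
  by rewrite mulr_ge0 ?invr_ge0 ?(ltW delta0) // mulr_ge0 ?exprn_ge0 // ler0n.
exists (n%:R * K1 + 1); apply: (path_inversion (A := pos_jac)
  (C := n%:R * jac_rate n eps M)) => //.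
- by move=> x; exact: pos0.
- by rewrite mulr_ge0.
- by move=> t x j /andP[t0 _]; exact: pos_space.
- by move=> t x tt; rewrite gt_eqF // (lt_le_trans delta0) // Jd.
- move=> t x i j tt; apply: (@invmx_bound R n _ B delta) => //; last exact: Jd.
  move=> k l; case/andP: tt => t0 tt.
  apply: (le_trans (pos_jac_bound aS aH eps0 rho_adm v0M x k l t0)).
  by rewrite lerD2l ler_wpM2l.
move=> s t x y /andP[s0 _] /andP[t0 _]; exact: pos_lipschitz.
Qed.

Lemma jac_det_neq0 t x : 0 <= t < T -> jac_det t x != 0.
Proof.
move=> tT; have [delta delta0 Jd] := Jpos tT.
by rewrite gt_eqF // (lt_le_trans delta0) // Jd // lexx andbT; case/andP: tT.
Qed.

Variable Y : R -> 'rV[R]_n -> 'rV[R]_n.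
Hypothesis posY : forall t x, 0 <= t < T -> pos t (Y t x) = x.

(** A right inverse of an injective map is a left inverse. *)
Lemma Ypos t x : 0 <= t < T -> Y t (pos t x) = x.
Proof.
move=> tT; have [K KP] := pos_inversion tT.
have [|_ tE] := KP t; first by rewrite lexx andbT; case/andP: tT.
by apply: (expanding_inj tE); rewrite posY.
Qed.

(** The particle that is in [x] at time [t] started from [Y t x]. *)
Definition sol (t : R) (x : 'rV[R]_n) : 'rV[R]_n := vel t (Y t x).

(** Spatial and time derivatives of [sol], in terms of the starting point [z]. *)
Definition sol_jac (t : R) (z : 'rV[R]_n) : 'M[R]_n :=
  vel_jac t z *m invmx (pos_jac t z).

Definition sol_time (t : R) (z : 'rV[R]_n) i : R :=
  derive_time a t / a t * (sqnorm2 (vel t z) / c ^+ 2 - 1) * vel t z 0 i -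
  \sum_m sol_jac t z i m * (vel t z 0 m * iscale a t).

Section At.
Variables (t : R) (x : 'rV[R]_n).
Hypothesis tT : 0 <= t < T.
Local Notation F := (nbhs_slab T t x).
Local Notation fo := (first_order F (dslab t x)).
Let z : 'rV[R]_n := Y t x.
Let d0 := @dslab0 R n T t x.

(** The Lipschitz constant [K] of the inverses is uniform up to a time [tau] later
    than [t], so [Y p.1 p.2 - Y t x] is bounded by [K] times
    [p.2 - pos p.1 (Y t x)], which tends to [x - x]. *)
Lemma Y_cvg : Y p.1 p.2 @[p --> F] --> z.
Proof.
have [t0 tT'] := andP tT; pose tau := (t + T) / 2.
have ttau : t < tau by rewrite /tau; lra.
have tauT : 0 <= tau < T by rewrite /tau; apply/andP; split; lra.
have [K KP] := pos_inversion tauT.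
have near_tau : \forall p \near F, p.1 < tau.
  exact: (cvgr_lt _ (@nbhs_slab_fst R n T t x) _ ttau).
have gam : (p.1, z) @[p --> F] --> nbhs_slab T t z.
  apply: (@cvg_nbhs_slab _ _ _ _ F _ (fun p => p.1) (fun=> z)).
  - exact: nbhs_slab_fst.
  - exact: cvg_cst.
  exact: nbhs_slab_in.
have posc : pos p.1 z @[p --> F] --> x.
  rewrite -[x in X in _ --> X](posY x tT); apply: cvg_coord => j.
  apply: (cvg_comp _ (fun p : R * 'rV[R]_n => pos p.1 p.2 0 j) gam).
  exact: (fo_cvg (@dslab0 R n T t z) (fo_pos aS aH v0C rho_adm z tT j)).
have lim0 : K * `|p.2 - pos p.1 z| @[p --> F] --> (0 : R).
  rewrite -(mulr0 K) -(normr0 'rV[R]_n) -(subrr x).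
  apply: cvgMl_tmp; apply: cvg_norm; apply: cvgB => //.
  exact: nbhs_slab_snd.
apply/cvgrPdist_le => e e0.
apply: filterS3 near_tau (nbhs_slab_in T t x) (cvgr_le _ lim0 _ e0).
move=> p ptau pT; apply: le_trans.
have [|_ pE] := KP p.1; first by case/andP: pT => -> _ /=; exact: ltW.
by rewrite distrC -{2}(posY p.2 pT); exact: pE.
Qed.

Lemma Y_slab : (p.1, Y p.1 p.2) @[p --> F] --> nbhs_slab T t z.
Proof.
apply: (@cvg_nbhs_slab _ _ _ _ F _ (fun p => p.1) (fun p => Y p.1 p.2)).
- exact: nbhs_slab_fst.
- exact: Y_cvg.
exact: nbhs_slab_in.
Qed.

(** Obtained by differentiating [pos t (Y t x) = x] in space and time. *)
Lemma fo_Y j : fo (fun p => Y p.1 p.2 0 j) (z 0 j)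
  (fun k => \sum_i invmx (pos_jac t z) j i *
     ((k == Some i)%:R - vel t z 0 i * iscale a t * (k == None)%:R)).
Proof.
have /choice[Phi PhiP] i : exists Phi : option 'I_n -> R * 'rV[R]_n -> R,
    (forall k, Phi k p @[p --> nbhs_slab T t z] -->
      if k is Some j then pos_jac t z i j else vel t z 0 i * iscale a t) /\
    (\forall p \near nbhs_slab T t z, pos p.1 p.2 0 i = pos t z 0 i +
      \sum_k dslab t z k p * Phi k p).
  by have [Phi PA gE] := fo_pos aS aH v0C rho_adm z tT i; exists Phi.
pose r i (p : R * 'rV[R]_n) := dslab t x (Some i) p -
  dslab t x None p * Phi i None (p.1, Y p.1 p.2).
have rfo i : fo (r i) 0 (fun k => (k == Some i)%:R -
    vel t z 0 i * iscale a t * (k == None)%:R).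
  have A : fo (fun p => dslab t x None p * Phi i None (p.1, Y p.1 p.2)) 0
      (fun k => vel t z 0 i * iscale a t * (k == None)%:R).
    apply: (fo_subst1 (fo_coord (dslab t x) None) (s := vel t z 0 i * iscale a t)
      (S := fun p => Phi i None (p.1, Y p.1 p.2))).
      exact: (cvg_comp _ _ Y_slab ((PhiP i).1 None)).
    by apply: nearW => p; rewrite add0r.
  apply: fo_eq (foD (fo_coord (F := F) (dslab t x) (Some i)) (foZ (-1) A)).
  - by apply: nearW => p; rewrite mulN1r.
  - by rewrite mulr0 addr0.
  by move=> k; rewrite mulN1r.
apply: (fo_solve (y := fun j p => Y p.1 p.2 0 j) (y0 := fun j => z 0 j)
  (Phi := fun p => \matrix_(i, k) Phi i (Some k) (p.1, Y p.1 p.2))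
  (A := pos_jac t z) _ (jac_det_neq0 z tT) rfo).
- move=> i k; under eq_fun do rewrite mxE.
  exact: (cvg_comp _ _ Y_slab ((PhiP i).1 (Some k))).
have posE : \forall p \near nbhs_slab T t z, forall i,
    pos p.1 p.2 0 i = pos t z 0 i + \sum_k dslab t z k p * Phi i k p.
  by apply: filter_forall => i; exact: (PhiP i).2.
have YE : \forall p \near F, forall i, pos p.1 (Y p.1 p.2) 0 i = pos t z 0 i +
    \sum_k dslab t z k (p.1, Y p.1 p.2) * Phi i k (p.1, Y p.1 p.2).
  exact: Y_slab _ posE.
apply: filterS2 YE (nbhs_slab_in T t x) => p YE pT i.
have := YE i; rewrite posY // (posY x tT) sum_option /= /r /dslab /= => ->.
under eq_bigr do rewrite mxE mulrC.
by ring.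
Qed.

Lemma fo_sol i : fo (fun p => sol p.1 p.2 0 i) (sol t x 0 i)
  (fun k => if k is Some m then sol_jac t z i m else sol_time t z i).
Proof.
pose L (j : 'I_n) (k : option 'I_n) := \sum_i invmx (pos_jac t z) j i *
     ((k == Some i)%:R - vel t z 0 i * iscale a t * (k == None)%:R).
pose Mk (k' k : option 'I_n) : R :=
  if k' is Some j then L j k else (k == None)%:R.
have dM k' : fo (fun p => dslab t z k' (p.1, Y p.1 p.2)) 0 (Mk k').
  case: k' => [j|]; first exact: (foB (fo_Y j)).
  exact: (fo_coord (dslab t x) None).
apply: (fo_eq _ (erefl _) _ (fo_chain Y_slab dM
  (fo_vel aS aH v0C rho_adm z tT i))); first exact: nearW.
have LS j m : L j (Some m) = invmx (pos_jac t z) j m.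
  rewrite /L (bigD1 m) //= eqxx mulr0 subr0 mulr1 big1 ?addr0 // => l lm.
  by rewrite (inj_eq Some_inj) eq_sym (negPf lm) mulr0 subr0 mulr0.
have LN j : L j None = - \sum_m invmx (pos_jac t z) j m * (vel t z 0 m * iscale a t).
  rewrite /L -sumrN; apply: eq_bigr => l _.
  by rewrite /= mulr1 sub0r mulrN.
case=> [m|]; rewrite sum_option /Mk /=.
  rewrite mulr0 add0r /sol_jac mxE; apply: eq_bigr => j _.
  by rewrite LS.
rewrite mulr1 /sol_time; congr (_ + _).
under eq_bigr do rewrite LN mulrN mulr_sumr.
rewrite sumrN; congr (- _); rewrite exchange_big /=; apply: eq_bigr => m _.
have -> : sol_jac t z i m = \sum_j vel_jac t z i j * invmx (pos_jac t z) j m.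
  by rewrite [LHS]mxE.
rewrite mulr_suml; apply: eq_bigr => j _.
exact: mulrA.
Qed.

Lemma sol_jac_cvg i m : sol_jac p.1 (Y p.1 p.2) i m @[p --> F] --> sol_jac t z i m.
Proof.
rewrite mxE; under eq_fun do rewrite mxE.
apply: cvg_bigsum => j _; apply: cvgM.
  apply: (cvg_comp _ (fun p : R * 'rV[R]_n => vel_jac p.1 p.2 i j) Y_slab).
  exact: vel_jac_cvg.
apply: (@cvg_invmx R _ F _ n (fun p => pos_jac p.1 (Y p.1 p.2))) => [k l|].
  apply: (cvg_comp _ (fun p : R * 'rV[R]_n => pos_jac p.1 p.2 k l) Y_slab).
  exact: pos_jac_cvg.
exact: jac_det_neq0.
Qed.

Lemma sol_coord_cvg i : vel p.1 (Y p.1 p.2) 0 i @[p --> F] --> vel t z 0 i.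
Proof.
apply: (cvg_comp _ (fun p : R * 'rV[R]_n => vel p.1 p.2 0 i) Y_slab).
exact: vel_cvg.
Qed.

Lemma sol_time_cvg i : sol_time p.1 (Y p.1 p.2) i @[p --> F] --> sol_time t z i.
Proof.
apply: cvgB.
  apply: cvgM; last exact: sol_coord_cvg.
  apply: cvgM; first exact: hubble_cvg.
  apply: cvgB; last exact: cvg_cst.
  apply: cvgMr_tmp; apply: cvg_bigsum => k _.
  by apply: cvgM; exact: sol_coord_cvg.
apply: cvg_bigsum => m _; apply: cvgM; first exact: sol_jac_cvg.
by apply: cvgM; [exact: sol_coord_cvg|exact: iscale_cvg].
Qed.

Lemma sol_partial i j : has_partial (fun y => sol t y 0 i) j x /\
  partial (fun y => sol t y 0 i) j x = sol_jac t z i j.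
Proof.
by apply: partial_of_fo; exact: (fo_slab_space (g := fun s y => sol s y 0 i) tT
  (fo_sol i)).
Qed.

Lemma sol_dtime i : derivable_time (fun s => sol s x 0 i) t /\
  derive_time (fun s => sol s x 0 i) t = sol_time t z i.
Proof.
apply: is_dtimeE; first by case/andP: tT.
exact: (fo_slab_time (g := fun s y => sol s y 0 i) tT (fo_sol i)).
Qed.

End At.

Lemma sol_jacobian t x : 0 <= t < T ->
  jacobian_mx (sol t) x = sol_jac t (Y t x).
Proof. by move=> tT; apply/matrixP => i j; rewrite mxE (sol_partial x tT i j).2. Qed.

Lemma sol_classical : classical_solution c a (fun x => eps *: v0 x) T sol.
Proof.
split.
- split.
  + by move=> t x i tT; exact: (sol_dtime x tT i).1.
  + by move=> t x i j tT; exact: (sol_partial x tT i j).1.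
  + apply/subspace_continuousP => -[t x] tT; have {}tT : 0 <= t < T := tT; apply: cvg_coord => i.
    exact: sol_coord_cvg.
  + move=> i; apply/subspace_continuousP => -[t x] tT.
    have {}tT : 0 <= t < T := tT.
    suff : derive_time (fun s => sol s p.2 0 i) p.1 @[p --> nbhs_slab T t x] -->
        derive_time (fun s => sol s x 0 i) t by [].
    rewrite (sol_dtime x tT i).2.
    apply: (cvg_near_eq _ (sol_time_cvg (x := x) tT (i := i))).
    apply: filterS (nbhs_slab_in T t x) => p pT.
    exact: (sol_dtime p.2 pT i).2.
  move=> i j; apply/subspace_continuousP => -[t x] tT.
  have {}tT : 0 <= t < T := tT.
  suff : partial (fun y => sol p.1 y 0 i) j p.2 @[p --> nbhs_slab T t x] -->
      partial (fun y => sol t y 0 i) j x by [].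
  rewrite (sol_partial x tT i j).2.
  apply: (cvg_near_eq _ (sol_jac_cvg (x := x) tT (i := i) (m := j))).
  apply: filterS (nbhs_slab_in T t x) => p pT.
  exact: (sol_partial p.2 pT i j).2.
- move=> t x i tT; rewrite (sol_dtime x tT i).2 /sol_time -/(sol t x).
  have -> : \sum_j sol t x 0 j / a t * partial (fun y => sol t y 0 i) j x =
      \sum_m sol_jac t (Y t x) i m * (sol t x 0 m * iscale a t).
    by apply: eq_bigr => j _; rewrite (sol_partial x tT i j).2 mulrC.
  by rewrite -/(sol t x); ring.
move=> x; have T0T : 0 <= (0 : R) < T by apply/andP; split.
have Y0 : Y 0 x = x by rewrite -{2}(posY x T0T) pos0.
by rewrite /sol Y0 vel0.
Qed.

End Existence.

(** * Uniqueness *)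

Lemma bounded_on_segment (R : realType) (f : R -> R) (t : R) : 0 <= t ->
  (forall s, 0 <= s <= t -> f u @[u --> nbhs_ge0 s] --> f s) ->
  exists B, forall s, 0 <= s <= t -> `|f s| <= B.
Proof.
move=> t0 fc; have [|c _ cmax] := @EVT_max R (fun s => `|f s|) 0 t t0.
  apply/subspace_continuousP => s /=; rewrite in_itv /= => st.
  apply: cvg_norm; apply: cvg_trans (fc s st); apply: cvg_app.
  by apply: within_subset => u /=; rewrite in_itv /= => /andP[].
by exists `|f c| => s st; apply: cmax; rewrite in_itv.
Qed.

Lemma dtime_expR (R : realType) (L s : R) :
  is_dtime (fun u => expR (L * u)) s (expR (L * s) * L).
Proof.
apply: dtime_of_derive; have lin : is_derive s (1 : R) ( *%R L) L.
  have := is_deriveZ L (is_derive_id s (1 : R)).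
  by rewrite [L *: 1]mulr1.
exact: (is_derive1_comp (is_derive_expR (L * s)) lin).
Qed.

Lemma weighted_am_gm (R : realType) (q x y B : R) : `|q| <= B ->
  2 * (x * (q * y)) <= B * (x * x + y * y).
Proof.
move=> qB; apply: le_trans (ler_norm _) _.
rewrite !normrM (ger0_norm (ler0n R 2)).
have -> : 2 * (`|x| * (`|q| * `|y|)) = `|q| * (2 * (`|x| * `|y|)) by ring.
apply: ler_pM => //.
have : `|x| * `|x| = x * x by rewrite -!expr2 real_normK ?num_real.
have : `|y| * `|y| = y * y by rewrite -!expr2 real_normK ?num_real.
by have := sqr_ge0 (`|x| - `|y|); rewrite expr2 mulrBl !mulrBr; lra.
Qed.

(** Gronwall's argument: if [B] bounds the coefficients, the squared norm [z] of
    the solution satisfies [z' <= 2 n B z], so [z * exp (- 2 n B t)] decreases from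
    0. *)
Lemma linear_ode_zero (R : realType) n (e : 'I_n -> R -> R)
    (m : 'I_n -> 'I_n -> R -> R) (t : R) : 0 <= t ->
  (forall i s, 0 <= s <= t -> is_dtime (e i) s (\sum_k m i k s * e k s)) ->
  (forall i k s, 0 <= s <= t -> m i k u @[u --> nbhs_ge0 s] --> m i k s) ->
  (forall i, e i 0 = 0) -> forall i, e i t = 0.
Proof.
move=> t0 eD mc e0.
have [B mB] : exists B, forall i k s, 0 <= s <= t -> `|m i k s| <= B.
  have [|B fB] := @bounded_on_segment R (fun s => \sum_i \sum_k `|m i k s|) t t0.
    move=> s st; apply: cvg_bigsum => i _; apply: cvg_bigsum => k _.
    by apply: cvg_norm; exact: mc.
  exists B => i k s st; apply: le_trans (le_trans (ler_norm _) (fB s st)).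
  rewrite (bigD1 i) //= (bigD1 k) //= -addrA lerDl addr_ge0 //.
    by apply: sumr_ge0 => l _.
  by apply: sumr_ge0 => l _; apply: sumr_ge0 => j _.
pose z s := \sum_i e i s * e i s.
pose dz s := \sum_i (e i s * (\sum_k m i k s * e k s) +
  e i s * (\sum_k m i k s * e k s)).
have zD s : 0 <= s <= t -> is_dtime z s (dz s).
  by move=> st; apply: dtime_sum => i; apply: dtimeM; exact: eD.
have z0 s : 0 <= z s by apply: sumr_ge0 => i _; rewrite -expr2 sqr_ge0.
have dzB s : 0 <= s <= t -> dz s <= 2 * n%:R * B * z s.
  move=> st; have -> : 2 * n%:R * B * z s =
      \sum_i \sum_k B * (e i s * e i s + e k s * e k s).
    under eq_bigr do rewrite -mulr_sumr big_split /= sumr_const card_ord -/(z s).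
    rewrite -mulr_sumr big_split /= sumr_const card_ord sumrMnl -/(z s).
    by rewrite -(mulr_natl (z s)); ring.
  apply: ler_sum => i _; rewrite mulr_sumr -big_split /=; apply: ler_sum => k _.
  by rewrite -mulr2n -mulr_natl; exact: weighted_am_gm (mB i k s st).
pose L := - (2 * n%:R * B).
have gle := @time_ge0_le R (fun s => -1 * (z s * expR (L * s)))
  (fun s => -1 * (expR (L * s) * dz s + z s * (expR (L * s) * L))) 0 t (lexx 0) t0.
have zt : z t * expR (L * t) <= 0.
  have : -1 * (z 0 * expR (L * 0)) <= -1 * (z t * expR (L * t)).
    apply: gle => s st; first by apply: dtimeZ; apply: dtimeM (zD s st) _; exact: dtime_expR.
    rewrite mulN1r oppr_ge0 mulrCA -mulrDr; apply: mulr_ge0_le0; first exact: expR_ge0.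
    by have := dzB s st; rewrite /L; lra.
  have -> : z 0 = 0 by apply: big1 => i _; rewrite e0 mulr0.
  by rewrite mul0r mulr0 mulN1r oppr_ge0.
have {}zt : z t = 0.
  apply/eqP; rewrite eq_le z0 andbT.
  by move: zt; rewrite pmulr_lle0 ?expR_gt0.
have e2 i : true -> 0 <= e i t * e i t by rewrite -expr2 sqr_ge0.
move=> i; apply/eqP; rewrite -sqrf_eq0 expr2; apply/eqP.
exact: (psumr_eq0P e2 zt).
Qed.

Section Uniqueness.
Variables (R : realType) (n : nat) (c : R) (a : R -> R).
Variables (v0 : 'rV[R]_n -> 'rV[R]_n) (eps T : R).
Hypotheses (aS : scale_factor a) (aH : assumption_H3 a) (v0C : C2_bounded v0).
Local Notation rho := (rho c v0 eps).
Hypothesis rho_adm : forall x, admissible (rho x).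
Local Notation pos := (pos c a v0 eps).
Local Notation vel := (vel c a v0 eps).
Variable w : R -> 'rV[R]_n -> 'rV[R]_n.
Hypothesis wsol : classical_solution c a (fun x => eps *: v0 x) T w.
Variable al : 'rV[R]_n.

Local Notation pw i j s x := (partial (fun y => w s y 0 i) j x).
Local Notation H s := (derive_time a s / a s).

Lemma pos_dtime j s : 0 <= s < T ->
  is_dtime (fun u => pos u al 0 j) s (vel s al 0 j * iscale a s).
Proof.
move=> sT.
exact: (fo_slab_time (g := fun u y => pos u y 0 j) sT
  (fo_pos aS aH v0C rho_adm al sT j)).
Qed.

Lemma vel_dtime i s : 0 <= s < T -> is_dtime (fun u => vel u al 0 i) s
  (H s * (sqnorm2 (vel s al) / c ^+ 2 - 1) * vel s al 0 i).
Proof.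
move=> sT.
exact: (fo_slab_time (g := fun u y => vel u y 0 i) sT
  (fo_vel aS aH v0C rho_adm al sT i)).
Qed.

Lemma path_slab s : 0 <= s < T ->
  (u, pos u al) @[u --> nbhs_ge0 s] --> nbhs_slab T s (pos s al).
Proof.
move=> sT; apply: (@cvg_nbhs_slab _ _ _ _ (nbhs_ge0 s) _ id (pos ^~ al)).
- exact: cvg_within.
- by apply: cvg_coord => j; exact: (dtime_cvg (@pos_dtime j s sT)).
have uT : \forall u \near s, u < T by apply: lt_nbhsl; case/andP: sT.
suff : \forall u \near s, 0 <= u -> 0 <= u < T by [].
by apply: filterS uT => u uT u0; rewrite u0.
Qed.

Lemma slab_continuous (f : R * 'rV[R]_n -> R) s x : 0 <= s < T ->
  {within slab n T, continuous f} -> f p @[p --> nbhs_slab T s x] --> f (s, x).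
Proof. by move=> sT /subspace_continuousP fc; exact: (fc (s, x)). Qed.

Lemma sol_path_dtime i s : 0 <= s < T ->
  is_dtime (fun u => w u (pos u al) 0 i) s
    (derive_time (fun u => w u (pos s al) 0 i) s +
     \sum_j pw i j s (pos s al) * (vel s al 0 j * iscale a s)).
Proof.
move=> sT; have wC := sol_C1 wsol; set x := pos s al.
have wfo := fo_slab (g := fun u y => w u y 0 i) (x := x) sT
  (fun u y uT => @C1_time _ _ _ _ wC u y i uT) (fun j y => @C1_space _ _ _ _ wC s y i j sT)
  (@slab_continuous _ s x sT (@C1_cont_time _ _ _ _ wC i))
  (fun j => @slab_continuous _ s x sT (@C1_cont_space _ _ _ _ wC i j)).
pose Mk (k : option 'I_n) (_ : 'I_1) : R :=
  if k is Some j then vel s al 0 j * iscale a s else 1.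
have dM k : first_order (nbhs_ge0 s) (dtime s)
    (fun u => dslab s x k (u, pos u al)) 0 (Mk k).
  case: k => [j|]; first exact: (foB (fo_of_dtime (@pos_dtime j s sT))).
  apply: fo_eq (fo_coord (dtime s) ord0) => //; first exact: nearW.
  by move=> k; rewrite ord1.
apply: dtime_of_fo; apply: fo_eq (fo_chain (path_slab sT) dM wfo) => //.
  exact: nearW.
by move=> k; rewrite sum_option mulr1.
Qed.

(** Along the characteristic [pos ^~ al] of the explicit flow, which a priori is
    not a characteristic of the solution [w], the difference of the two velocities
    satisfies a linear differential system with continuous coefficients. *)
Lemma sol_on_characteristic t : 0 <= t < T -> w t (pos t al) = vel t al.
Proof.
move=> /andP[t0 tT].
have sT s : 0 <= s <= t -> 0 <= s < T.
  by move=> /andP[s0 st]; rewrite s0 (le_lt_trans st).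
pose W s := w s (pos s al); pose V s := vel s al.
pose e i s := W s 0 i - V s 0 i.
(* the quadratic difference [|W|^2 - |V|^2] is written as the linear expression
   [\sum_k (W_k + V_k) e_k] in the unknown [e = W - V] *)
pose m i k s := - (pw i k s (pos s al) * iscale a s) +
  H s * (sqnorm2 (W s) / c ^+ 2 - 1) * (i == k)%:R +
  H s / c ^+ 2 * (W s 0 k + V s 0 k) * V s 0 i.
suff ez i : e i t = 0.
  by apply/rowP => i; apply/eqP; rewrite -subr_eq0; apply/eqP; exact: ez.
apply: (linear_ode_zero (e := e) (m := m)) => // {i}.
- move=> i s st; have := dtimeB (@sol_path_dtime i s (sT s st)) (@vel_dtime i s (sT s st)).
  rewrite [X in is_dtime _ _ X -> _](_ : _ = \sum_k m i k s * e k s) //.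
  have := sol_eq wsol (pos s al) i (sT s st).
  move=> /eqP; rewrite -!addrA addr_eq0 => /eqP ->.
  rewrite /m; under [RHS]eq_bigr do rewrite !mulrDl; rewrite !big_split /=.
  have E1 : \sum_k H s * (sqnorm2 (W s) / c ^+ 2 - 1) * (i == k)%:R * e k s =
      H s * (sqnorm2 (W s) / c ^+ 2 - 1) * e i s.
    rewrite (bigD1 i) //= eqxx mulr1 big1 ?addr0 // => k ki.
    by rewrite eq_sym (negPf ki) mulr0 mul0r.
  have E2 : \sum_k H s / c ^+ 2 * (W s 0 k + V s 0 k) * V s 0 i * e k s =
      H s / c ^+ 2 * V s 0 i * (sqnorm2 (W s) - sqnorm2 (V s)).
    rewrite /sqnorm2 -sumrB mulr_sumr; apply: eq_bigr => k _.
    by rewrite /e; ring.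
  have E3 : \sum_k - (pw i k s (pos s al) * iscale a s) * e k s =
      - (\sum_k W s 0 k / a s * pw i k s (pos s al)) +
      \sum_k pw i k s (pos s al) * (V s 0 k * iscale a s).
    rewrite -sumrN -big_split; apply: eq_bigr => k _.
    by rewrite /e /iscale /=; ring.
  by rewrite E1 E2 E3 /e -/(W s) -/(V s); ring.
- move=> i k s st; have Ws := path_slab (sT s st).
  have wC := sol_C1 wsol.
  have Wc l : W u 0 l @[u --> nbhs_ge0 s] --> W s 0 l.
    exact: (dtime_cvg (@sol_path_dtime l s (sT s st))).
  have Vc l : V u 0 l @[u --> nbhs_ge0 s] --> V s 0 l.
    exact: (dtime_cvg (@vel_dtime l s (sT s st))).
  have s0 : 0 <= s by case/andP: st.
  have ic : iscale a u @[u --> nbhs_ge0 s] --> iscale a s.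
    exact: (dtime_cvg (iscale_dtime aS s0)).
  have Hc : H u @[u --> nbhs_ge0 s] --> H s.
    apply: cvgM => //.
    exact: (dtime_cvg (derivable_timeP (scale_derivable2 aS s0))).
  have pc : pw i k u (pos u al) @[u --> nbhs_ge0 s] --> pw i k s (pos s al).
    apply: (cvg_comp _ (fun p : R * 'rV[R]_n => pw i k p.1 p.2) Ws).
    exact: (@slab_continuous _ s (pos s al) (sT s st) (@C1_cont_space _ _ _ _ wC i k)).
  apply: cvgD.
    apply: cvgD; first by apply: cvgN; exact: cvgM.
    apply: cvgMr_tmp; apply: cvgM => //; apply: cvgB; last exact: cvg_cst.
    by apply: cvgMr_tmp; apply: cvg_bigsum => l _; exact: cvgM.
  apply: cvgM => //; apply: cvgM; last exact: cvgD.
  exact: cvgMr_tmp.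
by move=> i; rewrite /e /W /V pos0 // vel0 // (sol_init wsol) subrr.
Qed.

End Uniqueness.

(** * Blow-up of the gradient *)

Lemma jacobian_le_grad_norm (R : realType) n (f : 'rV[R]_n -> 'rV[R]_n) x i j :
  `|jacobian_mx f x i j| <= grad_norm f x.
Proof.
rewrite /grad_norm -sqrtr_sqr ler_wsqrtr //.
rewrite (bigD1 i) //= (bigD1 j) //= -addrA lerDl addr_ge0 //.
  by apply: sumr_ge0 => l _; exact: sqr_ge0.
by apply: sumr_ge0 => l _; apply: sumr_ge0 => k _; exact: sqr_ge0.
Qed.

Section BlowUp.
Variables (R : realType) (n : nat) (c : R) (a : R -> R).
Variables (v0 : 'rV[R]_n -> 'rV[R]_n) (eps T : R).
Hypotheses (aS : scale_factor a) (aH : assumption_H3 a).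
Local Notation rho := (rho c v0 eps).
Local Notation kappa := (kappa c eps).
Hypothesis rho_adm : forall x, admissible (rho x).
Local Notation P t x := (lorentz (rho x * theta a t)).
Local Notation pos_pert := (pos_pert c a v0 eps).
Local Notation vel_pert := (vel_pert c a v0 eps).
Local Notation pos_jac := (pos_jac c a v0 eps).
Local Notation jac_det := (jac_det c a v0 eps).
Local Notation sol_jac := (sol_jac c a v0 eps).

(** The two perturbations commute, so eliminating the Jacobian matrix of the datum
    between those of position and velocity leaves a linear relation that forces
    the velocity gradient to be large where the flow is nearly singular. *)
Lemma jacobian_relation t x : jac_det t x != 0 ->
  (vel_pert t x - pos_pert t x *m sol_jac t x) *m pos_jac t x = vel_pert t x.
Proof.
move=> J0; have GJ : sol_jac t x *m pos_jac t x = vel_jac c a v0 eps t x.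
  by rewrite -mulmxA mulVmx ?mulmx1 // unitmxE unitfE.
have PQ : pos_pert t x *m vel_pert t x = vel_pert t x *m pos_pert t x.
  by rewrite !rank1_pert_comm; congr rank1_pert; ring.
rewrite mulmxBl -mulmxA GJ /(pos_jac t x) /vel_jac mulmxDr mulmx1.
by rewrite -!scalemxAr !mulmxA PQ addrK.
Qed.

Lemma scale_le s t : 0 <= s -> s <= t -> a s <= a t.
Proof.
move=> s0 st; apply: (@time_ge0_le R a (derive_time a)) => // u /andP[su _].
  by apply: scale_dtime => //; exact: le_trans su.
by apply: ltW; apply: H3_velocity => //; exact: le_trans su.
Qed.

Lemma lorentz3_bound t x : 0 <= t -> 0 <= P t x ^+ 3 <= 4.
Proof.
move=> t0; have [p1 p2 _] := lorentz_bounds (admissible_theta aS aH (rho_adm x) t0).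
have p0 : 0 <= P t x by lra.
have p3 : P t x <= 2 by have := sqr_ge0 (P t x - 1); rewrite sqrrB1; lra.
rewrite exprn_ge0 //= exprS.
have -> : (4 : R) = 2 * 2 by ring.
by apply: ler_pM => //; exact: exprn_ge0.
Qed.

Lemma vel_pert_det t x : 0 <= t <= T -> iscale a T ^+ n <= \det (vel_pert t x).
Proof.
move=> /andP[t0 tT]; have T0 : 0 <= T by exact: le_trans tT.
have [p1 p2 _] := lorentz_bounds (admissible_theta aS aH (rho_adm x) t0).
have /andP[i0 i1] := iscale_bounds aS aH t0.
have /andP[I0 _] := iscale_bounds aS aH T0.
have /andP[h0 h1] := theta_bounds aS aH t0.
have /andP[q0 q1] := lorentz3_bound x t0.
have iT : iscale a T <= iscale a t * P t x.
  apply: (@le_trans _ _ (iscale a t)); last by rewrite ler_peMr // ltW.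
  by rewrite lef_pV2 ?posrE ?scale_gt0 // scale_le.
have q2 : 0 < iscale a t * P t x by exact: lt_le_trans iT.
rewrite det_rank1_pert ?gt_eqF // -[leLHS]mulr1; apply: ler_pM => //.
- by rewrite exprn_ge0 // ltW.
- by apply: lerXn2r => //; rewrite nnegrE ltW.
rewrite lerDl mulr_ge0 ?sqnorm2_ge0 // divr_ge0 ?(ltW q2) //.
apply: mulr_ge0; first exact: sqr_ge0.
by apply: mulr_ge0 => //; apply: mulr_ge0 => //; exact: ltW.
Qed.

Lemma vel_pert_bound t x i j : 0 <= t -> `|vel_pert t x i j| <= 4.
Proof.
move=> t0; have [p1 p2 _] := lorentz_bounds (admissible_theta aS aH (rho_adm x) t0).
have /andP[i0 i1] := iscale_bounds aS aH t0.
have /andP[h0 h1] := theta_bounds aS aH t0.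
have /andP[q0 q1] := lorentz3_bound x t0.
have /andP[r0 r1] := rho_adm x.
have p3 : P t x <= 2 by have := sqr_ge0 (P t x - 1); rewrite sqrrB1; lra.
have p0 : 0 <= P t x by lra.
have -> : (4 : R) = 2 * 2 by ring.
apply: rank1_pert_bound.
  rewrite ger0_norm; last by rewrite mulr_ge0 // ltW.
  by rewrite -[leRHS]mul1r; apply: ler_pM => //; exact: ltW.
have it0 : 0 <= iscale a t * theta a t * P t x ^+ 3.
  by apply: mulr_ge0 => //; apply: mulr_ge0 => //; exact: ltW.
have it1 : iscale a t * theta a t * P t x ^+ 3 <= 4.
  rewrite -[leRHS]mul1r; apply: ler_pM => //.
    by apply: mulr_ge0 => //; exact: ltW.
  by rewrite -[leRHS]mul1r; apply: ler_pM => //; exact: ltW.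
rewrite ger0_norm; last by apply: mulr_ge0 => //; exact: sqr_ge0.
rewrite mulrAC (_ : 2 = 2^-1 * 4); last by field.
exact: ler_pM.
Qed.

Lemma pos_pert_bound t x i j : 0 <= t <= T -> `|pos_pert t x i j| <= 4 * T.
Proof.
move=> /andP[t0 tT]; have r := rho_adm x; have /andP[r0 r1] := r.
have dt := disp_lipschitz aS aH r (lexx 0) t0.
have st := disp_slope_lipschitz aS aH r r (lexx 0) t0.
rewrite disp0 // !subr0 (ger0_norm t0) in dt.
rewrite disp_slope0 // !subr0 (ger0_norm t0) in st.
have -> : 4 * T = 2 * (2 * T) by ring.
apply: rank1_pert_bound; first by apply: le_trans dt _; rewrite ler_pM2l.
have -> : `|2 * kappa * disp_slope a t (rho x) (rho x)| * sqnorm2 (v0 x) =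
    2 * rho x * `|disp_slope a t (rho x) (rho x)|.
  rewrite normrM ger0_norm; first by rewrite /(rho x); ring.
  by apply: mulr_ge0 => //; exact: sqr_ge0.
rewrite -[leRHS]mul1r; apply: ler_pM => //; first by apply: mulr_ge0.
  by move: r1; lra.
by apply: le_trans st _; rewrite ler_pM2l.
Qed.

(** If the entries of [sol_jac] were at most [A], the determinant of the left factor
    in [jacobian_relation] would be at most [C], and [jac_det] at least
    [\det vel_pert / C]. *)
Lemma sol_jac_unbounded (A : R) : 0 <= A -> 0 <= T -> exists2 eta, 0 < eta &
  forall t x, 0 <= t <= T -> 0 < jac_det t x < eta ->
    exists i j, A < `|sol_jac t x i j|.
Proof.
move=> A0 T0; have /andP[I0 _] := iscale_bounds aS aH T0.
pose b := 4 + n%:R * (4 * T * A); pose C := perm_count R n * b ^+ n.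
have b0 : 0 <= b by rewrite addr_ge0 // !mulr_ge0.
have C0 : 0 <= C by rewrite mulr_ge0 ?exprn_ge0 // ler0n.
exists (iscale a T ^+ n / (C + 1)); first by rewrite divr_gt0 ?exprn_gt0 // ltr_wpDl.
move=> t x tT /andP[J0 Jeta]; apply: contrapT => noij.
have GA i j : `|sol_jac t x i j| <= A.
  by rewrite leNgt; apply/negP => Aij; apply: noij; exists i, j.
have bd i j : `|(vel_pert t x - pos_pert t x *m sol_jac t x) i j| <= b.
  rewrite mxE [X in _ + X]mxE; apply: le_trans (ler_normB _ _) _; apply: lerD.
    by apply: vel_pert_bound; case/andP: tT.
  rewrite mxE; apply: le_trans (ler_norm_sum _ _ _) _.
  rewrite mulr_natl -[n in _ *+ n]card_ord -sumr_const.
  by apply: ler_sum => k _; rewrite normrM ler_pM // pos_pert_bound.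
have := congr1 determinant (jacobian_relation (lt0r_neq0 J0)).
rewrite det_mulmx => detE; have := vel_pert_det x tT; rewrite -detE => qle.
have : iscale a T ^+ n <= C * jac_det t x.
  apply: le_trans qle _; rewrite ler_pM2r //.
  by apply: le_trans (ler_norm _) _; exact: det_bound.
rewrite leNgt => /negP; apply; move: Jeta.
rewrite ltr_pdivlMr ?ltr_wpDl // => /(le_lt_trans _); apply.
by rewrite mulrC ler_pM2l // lerDl.
Qed.

End BlowUp.

Unset Implicit Arguments.

Theorem theorem1p2 (R : realType) (n : nat) (c : R) (a : R -> R)
    (v0 : 'rV[R]_n -> 'rV[R]_n)
    (n_ge1 : (1 <= n)%N) (c_gt0 : 0 < c)
    (a_scale : scale_factor a) (a_H3 : assumption_H3 a)
    (v0_C2 : C2_bounded v0)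
    (v0_det : (ereal_inf [set (\det (jacobian_mx v0 alpha))%:E
                         | alpha in [set: 'rV[R]_n]] < 0)%E) :
  exists eps0 : R, 0 < eps0 /\
    forall eps : R, 0 < eps < eps0 ->
      exists T : R, [/\ 0 < T,
        exists v : R -> 'rV[R]_n -> 'rV[R]_n,
          classical_solution c a (fun x => eps *: v0 x) T v &
        forall v : R -> 'rV[R]_n -> 'rV[R]_n,
          classical_solution c a (fun x => eps *: v0 x) T v ->
          gradient_blows_up T v].
Proof.
have [M0 v0M0] := C2_bound v0_C2; pose M := `|M0|.
have M_ge0 : 0 <= M by exact: normr_ge0.
have v0M x i : `|v0 x 0 i| <= M.
  by have [+ _ _] := v0M0 x; move=> /(_ i) /le_trans; apply; exact: ler_norm.
have D0M x i j : `|jacobian_mx v0 x i j| <= M.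
  rewrite mxE; have [_ + _] := v0M0 x; move=> /(_ i j) /le_trans; apply.
  exact: ler_norm.
(* with [eps < c / (2 N)] the initial speeds satisfy [rho <= 1/2] *)
pose N := n%:R * M ^+ 2 + 1.
have NM : 0 <= n%:R * M ^+ 2 by rewrite mulr_ge0 // sqr_ge0.
have N0 : 0 < N by rewrite /N; lra.
exists (c / (2 * N)); split; first by rewrite divr_gt0 // mulr_gt0.
move=> eps /andP[eps_gt0 eps_lt].
have adm x : admissible (rho c v0 eps x).
  have s0 := sqnorm2_ge0 (v0 x); have k0 := kappa_ge0 c eps.
  apply/andP; split; first exact: mulr_ge0.
  have sM : sqnorm2 (v0 x) <= n%:R * M ^+ 2.
    rewrite mulr_natl -[n in _ *+ n]card_ord -sumr_const.
    apply: ler_sum => i _; rewrite -real_normK ?num_real //.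
    by apply: lerXn2r; rewrite ?nnegrE.
  have ec : eps / c <= (2 * N)^-1.
    by rewrite ler_pdivrMr // mulrC ltW.
  have kN : kappa c eps <= ((2 * N)^-1) ^+ 2.
    by apply: lerXn2r => //; rewrite nnegrE ?invr_ge0 ?divr_ge0 ?mulr_ge0 // ltW.
  apply: (@le_trans _ _ (((2 * N)^-1) ^+ 2 * N)).
    by apply: ler_pM => //; rewrite /N; lra.
  have -> : ((2 * N)^-1) ^+ 2 * N = 2^-1 * (2 * N)^-1.
    by field; rewrite gt_eqF.
  rewrite ler_piMr ?invr_ge0 // invf_le1 ?mulr_gt0 //.
  by rewrite /N; lra.
have [_ [al _ <-]] := ereal_inf_lt v0_det; rewrite lte_fin => det_lt0.
have [t1 t10 J1] := jac_det_lt0 a_scale a_H3 eps_gt0 adm det_lt0.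
have [T [T0 Jpos Jsmall]] := critical_time
  (jac_det0 a_scale a_H3 adm)
  (jac_det_lipschitz a_scale a_H3 eps_gt0 adm D0M M_ge0)
  (ex_intro _ t1 (ex_intro _ al (conj t10 J1))).
have inv := pos_inversion a_scale a_H3 v0_C2 eps_gt0 adm D0M M_ge0 Jpos.
have /choice[Y' Y'P] (p : R * 'rV[R]_n) : exists y, 0 <= p.1 < T ->
    pos c a v0 eps p.1 y = p.2.
  have [pT|] := boolP (0 <= p.1 < T); last by exists 0.
  have [K /(_ p.1)[|ps _]] := inv _ pT; first by rewrite lexx andbT; case/andP: pT.
  by have [y yE] := ps p.2; exists y.
pose Y t x := Y' (t, x).
have posY t x : 0 <= t < T -> pos c a v0 eps t (Y t x) = x by exact: (Y'P (t, x)).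
have solC := sol_classical a_scale a_H3 v0_C2 eps_gt0 adm D0M M_ge0 T0 Jpos posY.
exists T; split => //; first by exists (sol c a v0 eps Y).
move=> w wsol; apply/cvgeyPge => A.
have [eta eta0 small] := sol_jac_unbounded a_scale a_H3 adm (normr_ge0 A) (ltW T0).
near=> t.
have t0 : 0 <= t by near: t; exact: nbhs_left_ge.
have tT : t < T by near: t; exact: nbhs_left_lt.
have t0T : 0 <= t < T by rewrite t0.
have [x Jx] : exists x, jac_det c a v0 eps t x < eta by near: t; exact: Jsmall.
have J0 : 0 < jac_det c a v0 eps t x.
  have [delta delta0 dJ] := Jpos t t0T.
  by apply: lt_le_trans delta0 (dJ t x _); rewrite t0 lexx.
have [||i [j Gij]] := small t x; [by rewrite t0 ltW|by rewrite J0|].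
(* every solution is the constructed one, so its gradient is known at [pos t x] *)
have wE : w t = sol c a v0 eps Y t.
  apply/funext => y; rewrite -{1}(posY t y t0T).
  exact: (sol_on_characteristic a_scale a_H3 v0_C2 adm wsol _ t0T).
have YX : Y t (pos c a v0 eps t x) = x.
  exact: (Ypos a_scale a_H3 v0_C2 eps_gt0 adm D0M M_ge0 Jpos posY).
apply: le_trans (ereal_sup_ubound _); last by exists (pos c a v0 eps t x).
rewrite lee_fin; apply: le_trans (ler_norm A) (le_trans (ltW Gij) _).
rewrite -{1}YX -(sol_jacobian a_scale a_H3 v0_C2 eps_gt0 adm D0M M_ge0 Jpos posY) //.
by rewrite wE; exact: jacobian_le_grad_norm.
Unshelve. all: by end_near.
Qed.
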